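(* The following points of $\operatorname{Gr}(7,16)=\operatorname{Gr}(7,S^{+})$ (with notation and matrices given in the context) are $\operatorname{Spin}(10)$-semistable: (1) the point $[P_{\mathrm{cusp}}]$ parametrizing the 7-cuspidal curve with heptagonal symmetry $C_{\mathrm{cusp}}$; (2) the point $[P_{\mathrm{rib}}]$ parametrizing the genus 7 balanced ribbon $C_{\mathrm{rib}}$; (3) the points $[P_{\mathrm{nod},t}]$ parametrizing the reducible nodal curves $C_{\mathrm{nod},t}$, for every $t=[t_0:t_1]\in\mathbb{P}^1$ with $t\neq 1,\infty$ (that is, $t_0\neq t_1$ and $t_1\neq 0$).
   Context: Work over $\mathbb{C}$. Let $V=\mathbb{C}^{10}$ with basis $e_{-1},\dots,e_{-5},e_1,\dots,e_5$ and quadratic form $Q=\sum_{i=1}^5 z_{-i}z_i$ in the corresponding coordinates. Put $U_\infty=\operatorname{Span}(e_1,\dots,e_5)$ and $S^{+}=\bigwedge^{\mathrm{even}}U_\infty$, the 16-dimensional half-spin representation of $\operatorname{Spin}(10)=\operatorname{Spin}(V,Q)$ (in the Clifford algebra $v\cdot w+w\cdot v=B(v,w)$, $B(v,w)=Q(v+w)-Q(v)-Q(w)$; $e_i$ acts on $\bigwedge U_\infty$ by left wedging and $e_{-i}$ by contraction against $e_i$). $S^{+}$ has basis $e_I=e_{i_1}\wedge\cdots\wedge e_{i_k}$ for $I=\{i_1<\cdots<i_k\}\subset\{1,\dots,5\}$, $k$ even, always ordered as $1,e_{12},e_{13},e_{14},e_{15},e_{23},e_{24},e_{25},e_{34},e_{35},e_{45},e_{1234},e_{1235},e_{1245},e_{1345},e_{2345}$.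 A point $[P]\in\operatorname{Gr}(7,S^{+})$ is $\operatorname{Spin}(10)$-semistable if, for the Plücker linearization (that is, $\operatorname{Gr}(7,S^+)\subset\mathbb{P}(\bigwedge^7S^{+})$), there is a homogeneous $\operatorname{Spin}(10)$-invariant polynomial of positive degree on $\bigwedge^7S^{+}$ not vanishing at $[P]$. The orthogonal Grassmannian $\operatorname{OG}(5,10)\subset\mathbb{P}(S^{+})=\mathbb{P}^{15}$ is the variety of half spinors of maximal isotropic subspaces of $(V,Q)$ in the family with half spinor in $S^{+}$. The curves named above are, up to isomorphism, the intersections of the following 6-dimensional linear subspaces with $\operatorname{OG}(5,10)$. $P_{\mathrm{cusp}}$, $P_{\mathrm{rib}}$, $P_{\mathrm{nod},t}$ are the projectivizations of the 7-dimensional subspaces of $S^{+}$ spanned by: - $P_{\mathrm{cusp}}$: $-\tfrac35e_{15}+e_{23}$, $\ \tfrac15e_{25}+e_{34}$, $\ \tfrac34e_{35}+e_{45}$, $\ 30\cdot 1+e_{1234}$, $\ \tfrac89e_{1235}+e_{1245}$, $\ -2e_{12}+e_{1345}$, $\ -\tfrac{15}{2}e_{14}+e_{2345}$. - $P_{\mathrm{rib}}$: $e_{14}+e_{23}$, $\ \tfrac12e_{15}+e_{24}$, $\ 2e_{25}+e_{34}$, $\ e_{35}$, $\ e_{1245}$, $\ e_{12}+e_{1345}$, $\ e_{13}+e_{2345}$. - $P_{\mathrm{nod},t}$, for $t=[t_0:t_1]$ with chosen representative $(t_0,t_1)$: $e_{12}+e_{13}$, $\ e_{24}$, $\ e_{34}$,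 $\ (t_0t_1-t_1^2)\cdot1+(t_0-t_1)e_{15}+t_1e_{23}+t_1e_{25}+t_0e_{35}$, $\ e_{23}+e_{25}+e_{45}$, $\ e_{1235}$, $\ e_{1345}$. Here $t=1$ means $t_0=t_1$, and $t=\infty$ means $t_1=0$. Description of the curves. $C_{\mathrm{cusp}}\subset\mathbb{P}^6$ is the section by the hyperplane $y_7=y_0$ of the tangent developable of the rational normal curve in $\mathbb{P}^7$ (in the coordinates where the developable is the closure of the image of $(s,t,u,v)\mapsto[7s^6u:6s^5tu+s^6v:5s^4t^2u+2s^5tv:4s^3t^3u+3s^4t^2v:3s^2t^4u+4s^3t^3v:2st^5u+5s^2t^4v:t^6u+6st^5v:7t^6v]$). $C_{\mathrm{rib}}\subset\mathbb{P}^6$ is the scheme defined by the quadrics $y_2y_3-2y_1y_4+y_0y_5$, $y_2y_4-2y_1y_5+y_0y_6$, $y_3^2-2y_2y_4+y_1y_5$, $y_3y_4-2y_2y_5+y_1y_6$, $-y_1^2+y_0y_2$, $-y_1y_2+y_0y_3$, $-y_2^2+y_1y_3$, $-y_4^2+y_3y_5$, $-y_4y_5+y_3y_6$, $-y_5^2+y_4y_6$. $C_{\mathrm{nod},t}\subset\mathbb{P}^6$ is the scheme defined by the quadrics $y_2y_6$, $y_1y_6$, $y_3y_5-y_4y_5+y_4y_6$, $y_1y_5$, $y_0y_5$, $y_0y_4-y_2y_4+y_3y_4-y_4y_5+y_4y_6$, $t_0y_2y_3-t_1y_2y_4+(-t_0+t_1)y_3y_4+(t_0-t_1)y_4y_5+(-t_0+t_1)y_4y_6$,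 $y_1y_3-y_2y_3+y_3y_4-y_4y_5+y_4y_6$, $y_0y_3-y_2y_3+y_3^2-y_4y_5+y_3y_6+y_4y_6$, $y_0y_2-y_1y_2+y_2y_3-y_2y_4$. *)

(* Defs.v *)
From HB Require Import structures.
From mathcomp Require Import all_boot all_order all_algebra.
From mathcomp Require Export complex mpoly reals.

Set Implicit Arguments.
Unset Strict Implicit.
Unset Printing Implicit Defensive.

Import GRing.Theory.
Local Open Scope ring_scope.

(* The subset {i_1 < ... < i_k} of {1, ..., 5} is represented by a subset of
   'I_5, the label i standing for the ordinal of value i - 1. *)

Section Spin.
Variable F : fieldType.

(* v = (x, y) is the vector \sum_i (x_i e_{-i} + y_i e_i). *)
Definition quadV : Type := ('rV[F]_5 * 'rV[F]_5)%type.

Definition Q (v : quadV) : F := \sum_(i < 5) v.1 0 i * v.2 0 i.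

(* The exterior algebra of U_oo = Span(e_1, ..., e_5): s I is the coefficient
   of s on e_I. *)
Definition spinor : Type := {ffun {set 'I_5} -> F}.

Definition spinor_basis (I : {set 'I_5}) : spinor := [ffun J : {set 'I_5} => (J == I)%:R].

(* e_i /\ e_J = (-1)^#{j in J | j < i} e_(i |: J) if i \notin J, and contraction
   against e_i is given by the same sign on the sets containing i. *)
Definition wedge_sign (i : 'I_5) (J : {set 'I_5}) : F :=
  (-1) ^+ #|[set j in J | (j < i)%N]|.

Definition wedge (i : 'I_5) (s : spinor) : spinor :=
  [ffun I : {set 'I_5} => if i \in I then wedge_sign i I * s (I :\ i) else 0].

Definition contract (i : 'I_5) (s : spinor) : spinor :=
  [ffun I : {set 'I_5} => if i \in I then 0 else wedge_sign i I * s (i |: I)].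

Definition clifford (v : quadV) (s : spinor) : spinor :=
  [ffun I : {set 'I_5} => \sum_(i < 5) (v.1 0 i * contract i s I + v.2 0 i * wedge i s I)].

(* The Clifford algebra of (V, Q), of dimension 2 ^ 10, is identified through
   its action with the whole of End(spinor).  Spin(V, Q) is its group of
   products of an even number of vectors v with Q v = 1; over the complex
   numbers these are all the even units x with x V x^-1 = V and spinor norm 1. *)
Definition in_Spin (g : spinor -> spinor) : Prop :=
  exists vs : seq quadV,
    [/\ ~~ odd (size vs), forall v, v \in vs -> Q v = 1
      & forall s, g s = foldr clifford s vs].

Definition half_labels : seq (seq nat) :=
  [:: [::]; [:: 1; 2]; [:: 1; 3]; [:: 1; 4]; [:: 1; 5]; [:: 2; 3]; [:: 2; 4];
      [:: 2; 5]; [:: 3; 4]; [:: 3; 5]; [:: 4; 5]; [:: 1; 2; 3; 4];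
      [:: 1; 2; 3; 5]; [:: 1; 2; 4; 5]; [:: 1; 3; 4; 5]; [:: 2; 3; 4; 5]]%N.

Definition half_set (k : 'I_16) : {set 'I_5} :=
  [set i : 'I_5 | i.+1 \in nth [::] half_labels k].

(* S^+ is 'cV[F]_16, by coordinates on the basis e_I, I even, in the order of
   half_labels. *)
Definition e (I : seq nat) : 'cV[F]_16 :=
  \col_(k < 16) (nth [::] half_labels k == I)%:R.

Definition half_spin_mx (g : spinor -> spinor) : 'M[F]_16 :=
  \matrix_(k, l) g (spinor_basis (half_set l)) (half_set k).

(* The 7-th exterior power of S^+ is 'cV[F]_wedge_dim, by coordinates on the
   basis f_K(0) /\ ... /\ f_K(6), where f is the ordered basis of S^+ and
   K : 'I_7 -> 'I_16 runs over the increasing maps. *)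
Definition multi_index : finType :=
  {K : {ffun 'I_7 -> 'I_16} |
     [forall a : 'I_7, forall b : 'I_7, (a < b)%N ==> (K a < K b)%N]}.

Definition wedge_dim : nat := #|{: multi_index}|.

Definition mindex (k : 'I_wedge_dim) : {ffun 'I_7 -> 'I_16} :=
  val (enum_val k : multi_index).

Definition wedge7_mx (A : 'M[F]_16) : 'M[F]_wedge_dim :=
  \matrix_(k, l) \det (mxsub (mindex k) (mindex l) A).

Definition plucker (b : 7.-tuple 'cV[F]_16) : 'cV[F]_wedge_dim :=
  \col_k \det (\matrix_(a < 7, c < 7) tnth b c (mindex k a) 0).

Definition evalW (f : {mpoly F[wedge_dim]}) (w : 'cV[F]_wedge_dim) : F :=
  f.@[fun k => w k 0].

Definition Spin_invariant (f : {mpoly F[wedge_dim]}) : Prop :=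
  forall g, in_Spin g -> forall w,
    evalW f (wedge7_mx (half_spin_mx g) *m w) = evalW f w.

(* The first clause says that P is a point of Gr(7, S^+). *)
Definition Spin_semistable (P : {vspace 'cV[F]_16}) : Prop :=
  \dim P = 7%N /\
  exists (d : nat) (f : {mpoly F[wedge_dim]}),
    [/\ (0 < d)%N, f \is d.-homog, Spin_invariant f
      & forall b : 7.-tuple 'cV[F]_16, basis_of P b -> evalW f (plucker b) != 0].

End Spin.

Arguments e F I%_N.

Section Points.
Variable F : fieldType.
Local Notation e := (e F).

Definition P_cusp : {vspace 'cV[F]_16} :=
  <<[:: - (3 / 5) *: e [:: 1; 5] + e [:: 2; 3];
        (1 / 5) *: e [:: 2; 5] + e [:: 3; 4];
        (3 / 4) *: e [:: 3; 5] + e [:: 4; 5];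
        30 *: e [::] + e [:: 1; 2; 3; 4];
        (8 / 9) *: e [:: 1; 2; 3; 5] + e [:: 1; 2; 4; 5];
        - 2 *: e [:: 1; 2] + e [:: 1; 3; 4; 5];
        - (15 / 2) *: e [:: 1; 4] + e [:: 2; 3; 4; 5]]%R>>%VS.

Definition P_rib : {vspace 'cV[F]_16} :=
  <<[:: e [:: 1; 4] + e [:: 2; 3];
        (1 / 2) *: e [:: 1; 5] + e [:: 2; 4];
        2 *: e [:: 2; 5] + e [:: 3; 4];
        e [:: 3; 5];
        e [:: 1; 2; 4; 5];
        e [:: 1; 2] + e [:: 1; 3; 4; 5];
        e [:: 1; 3] + e [:: 2; 3; 4; 5]]%R>>%VS.

Definition P_nod (t0 t1 : F) : {vspace 'cV[F]_16} :=
  <<[:: e [:: 1; 2] + e [:: 1; 3];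
        e [:: 2; 4];
        e [:: 3; 4];
        (t0 * t1 - t1 ^+ 2) *: e [::] + (t0 - t1) *: e [:: 1; 5]
          + t1 *: e [:: 2; 3] + t1 *: e [:: 2; 5] + t0 *: e [:: 3; 5];
        e [:: 2; 3] + e [:: 2; 5] + e [:: 4; 5];
        e [:: 1; 2; 3; 5];
        e [:: 1; 3; 4; 5]]%R>>%VS.

End Points.

(* Main.v *)
(* For vectors v of V the forms (s, t) |-> beta(s, v t), where beta pairs the two
   half-spin representations, give a Spin-invariant 4-tensor
   theta(s, t, s', t') = sum_v beta(s, v t) beta(s', v' t') on S^+, with v and v'
   running over dual bases of V.  Contracting four copies of an alternating
   7-tensor w with seven copies of theta is a quartic Spin-invariant polynomial in
   w.  On the Plucker point of a 7-space its value is a finite alternating sum of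
   products of the numbers theta(b_i, b_j, b_k, b_l) for a basis b, which is
   computed with integer polynomials in t1 and t0 - t1: it is a nonzero constant
   for the cuspidal curve and the ribbon, and a nonzero constant times
   t1^2 (t0 - t1)^3 for the nodal curves. *)

From Stdlib Require Import BinInt.
Require Import Defs.
From mathcomp Require Import all_boot all_order all_algebra.
From mathcomp Require Import complex mpoly reals.
From mathcomp Require Import fingroup perm ring ssrZ.

Set Implicit Arguments.
Unset Strict Implicit.
Unset Printing Implicit Defensive.

Import Order.TTheory GRing.Theory Num.Theory.
Local Open Scope ring_scope.

(** * Clifford relations, the spinor pairing and the invariant 4-tensor *)

Section Clifford.
Variable F : numFieldType.
Implicit Types (s t : spinor F) (I J : {set 'I_5}) (i j : 'I_5) (p q : bool * 'I_5).

Local Notation sg i J := (wedge_sign F i J).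

(** The forms [qform] are symmetric, so a [qform] with both arguments taken from one alternating
    tensor contributes nothing. The contraction therefore always puts its two arguments in different
    copies of w. The four copies are split into two pairs: three thetas join the first pair and use
    up six entries of each copy, three do the same for the second pair, and the seventh takes the
    remaining entry of all four. On a 7-space the plain sum has 7^28 terms. Grouped by pairs it
    becomes the sum of theta(i,j,k,l) C_ij C_kl, where the 7 by 7 matrix C is read off from the cube
    of the alternated theta in Lambda^2 tensor Lambda^2; this is small enough for exact evaluation.
    Invariance and evaluation rest on the same rule: the action of a spin element and the
    restriction to a 7-space are both index substitutions, which can be moved from w into theta.
    Signs of permutations are computed as Vandermonde products, so the computed number is the
    invariant times [vdm (iota 0 7)] to the fourth power. *)

Definition toggle i I : {set 'I_5} := if i \in I then I :\ i else i |: I.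

Lemma in_toggle i I j : (j \in toggle i I) = ((j == i) (+) (j \in I)).
Proof.
rewrite /toggle; case: (boolP (i \in I)) => iI; rewrite !inE;
  by case: eqVneq => // -> ; rewrite ?iI ?(negbTE iI).
Qed.

Lemma toggleK i : involutive (toggle i).
Proof. by move=> I; apply/setP => j; rewrite !in_toggle addbA addbb. Qed.

Lemma toggleC i j I : toggle i (toggle j I) = toggle j (toggle i I).
Proof. by apply/setP => k; rewrite !in_toggle addbCA. Qed.

Lemma toggle_setC i I : ~: toggle i I = toggle i (~: I).
Proof. by apply/setP => j; rewrite !inE !in_toggle inE addbN. Qed.

Lemma wedge_signE i J : sg i J = \prod_(j < 5) (if (j \in J) && (j < i)%N then -1 else 1).
Proof.
rewrite /wedge_sign -big_mkcond /= prodr_const; congr (_ ^+ _).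
by apply: eq_card => j; rewrite !inE.
Qed.

Lemma wedge_sign_toggle i j J :
  sg i (toggle j J) = (if (j < i)%N then -1 else 1) * sg i J.
Proof.
rewrite !wedge_signE (bigD1 j) //= [in RHS](bigD1 j) //= mulrA; congr (_ * _); last first.
  by apply: eq_bigr => k /negbTE kj; rewrite in_toggle kj.
by rewrite in_toggle eqxx /=; do 2![case: ifP => //]; case: (j \in J); case: (j < i)%N => //;
  rewrite ?mulrNN ?mulr1 ?mul1r.
Qed.

Lemma wedge_sign_sqr i J : sg i J * sg i J = 1.
Proof. by rewrite /wedge_sign -expr2 sqrr_sign. Qed.

(** The label [(false, i)] stands for e_{-i} and [(true, i)] for e_i. Both act as the same signed
    toggle of i, restricted by the membership of i in the target set, so one computation covers
    contraction and wedging. *)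
Definition op p s : spinor F :=
  [ffun I : {set 'I_5} => if (p.2 \in I) == p.1 then sg p.2 I * s (toggle p.2 I) else 0].

Definition dual p : bool * 'I_5 := (~~ p.1, p.2).

Definition vcoef (v : quadV F) p : F := if p.1 then v.2 0 p.2 else v.1 0 p.2.

Lemma dualK : involutive dual.
Proof. by case=> b i; rewrite /dual negbK. Qed.

Lemma sum_boolx (f : bool * 'I_5 -> F) : \sum_p f p = \sum_i (f (false, i) + f (true, i)).
Proof.
transitivity (\sum_(b : bool) \sum_i f (b, i)).
  by rewrite pair_bigA; apply: eq_bigr => -[].
rewrite exchange_big; apply: eq_bigr => i _.
by rewrite big_bool addrC.
Qed.

Lemma cliffordE v s I : clifford v s I = \sum_p vcoef v p * op p s I.
Proof.
rewrite ffunE sum_boolx; apply: eq_bigr => i _; rewrite !ffunE /vcoef /= /toggle.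
by case: (i \in I).
Qed.

(** These are the Clifford relations on the isotropic basis. For distinct labels both orders toggle
    the same two elements, and exactly one order meets a sign change, since toggling an element
    affects [wedge_sign] only at larger labels. *)
Lemma op_op p q s I :
  op p (op q s) I + op q (op p s) I = if q == dual p then s I else 0.
Proof.
case: p q => b i [c j]; rewrite !ffunE /dual xpair_eqE /= !in_toggle.
case: (eqVneq i j) => [<-|ij].
  rewrite andbT toggleK wedge_sign_toggle ltnn mul1r.
  case: (i \in I); case: b; case: c => //=;
    by rewrite ?mulr0 ?addr0 ?add0r ?mulrA ?wedge_sign_sqr ?mul1r.
rewrite andbF /=.
case: eqP => _; last by case: eqP; rewrite ?mulr0 addr0.
case: eqP => _; last by rewrite mulr0 addr0.
rewrite toggleC !wedge_sign_toggle.
have [lt|gt|e] := ltngtP i j; last by case/eqP: ij; apply: val_inj.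
- by rewrite mul1r; ring.
- by rewrite mul1r; ring.
Qed.

Lemma op_sum (I : finType) (c : I -> F) (s_ : I -> spinor F) p s :
  (forall K, s K = \sum_k c k * s_ k K) ->
  forall K, op p s K = \sum_k c k * op p (s_ k) K.
Proof.
move=> sE K; rewrite ffunE sE; case: ifP => h.
  by rewrite mulr_sumr; apply: eq_bigr => k _; rewrite ffunE h mulrCA.
by rewrite big1 // => k _; rewrite ffunE h mulr0.
Qed.

Lemma clifford_op v p s I :
  clifford v (op p s) I + op p (clifford v s) I = vcoef v (dual p) * s I.
Proof.
rewrite (op_sum _ (cliffordE v s)) cliffordE -big_split /= (bigD1 (dual p)) //= -mulrDr.
rewrite op_op dualK eqxx big1 ?addr0 // => q qp.
rewrite -mulrDr op_op; case: eqP => [e|]; last by rewrite mulr0.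
by case/eqP: qp; rewrite e dualK.
Qed.

Lemma sum_vcoef v : \sum_p vcoef v p * vcoef v (dual p) = Q v *+ 2.
Proof.
rewrite sum_boolx -sumrMnl; apply: eq_bigr => i _.
by rewrite /vcoef /= [X in _ + X]mulrC.
Qed.

(** Expanding the outer v and commuting each basis operator past the inner v gives v^2 = 2 Q(v) -
    v^2; this is why both sides are doubled first. *)
Lemma clifford_sqr v s I : clifford v (clifford v s) I = Q v * s I.
Proof.
have nz2 : (2%:R : F) != 0 by rewrite pnatr_eq0.
apply: (mulfI nz2); rewrite mulr_natl mulr2n mulrA mulr_natl -sum_vcoef.
have h p : op p (clifford v s) I = vcoef v (dual p) * s I - clifford v (op p s) I.
  by rewrite -clifford_op addrC addKr.
rewrite {1}cliffordE (eq_bigr _ (fun p _ => congr1 _ (h p))).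
under eq_bigr => p _ do rewrite mulrBr mulrA.
rewrite big_split /= -mulr_suml sumrN -addrA -[RHS]addr0; congr (_ + _).
apply/eqP; rewrite addrC subr_eq0; apply/eqP.
rewrite cliffordE; under eq_bigr => p _ do rewrite (op_sum _ (cliffordE v s)) mulr_sumr.
rewrite exchange_big; apply: eq_bigr => p _; rewrite cliffordE mulr_sumr.
by apply: eq_bigr => q _; rewrite mulrCA.
Qed.

Lemma clifford_sandwich v p s I : Q v = 1 ->
  clifford v (op p (clifford v s)) I = vcoef v (dual p) * clifford v s I - op p s I.
Proof.
move=> Qv; rewrite -clifford_op -addrA -[LHS]addr0; congr (_ + _).
apply/esym/eqP; rewrite subr_eq0; apply/eqP; congr (op p _ I).
by apply/ffunP => J; rewrite clifford_sqr Qv mul1r.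
Qed.

(** This sign is the coefficient of e_12345 in the reversal of e_I wedged with the complementary
    basis element. Hence [pairing s t] is the top coefficient of the reversal of s wedged with t. *)
Definition kappa I : F := \prod_(j < 5) (if j \in I then (-1) ^+ j else 1).

Definition pairing s t : F := \sum_I kappa I * (s I * t (~: I)).

Lemma prod_signs i : \prod_(j < 5) (if (j < i)%N then -1 else 1) = (-1) ^+ i :> F.
Proof.
by case: i => -[|[|[|[|[|m]]]]] // hi; rewrite !big_ord_recl big_ord0 /=; ring.
Qed.

Lemma wedge_signC i J : sg i J * sg i (~: J) = (-1) ^+ i.
Proof.
rewrite !wedge_signE -big_split -prod_signs; apply: eq_bigr => j _ /=.
by rewrite inE; case: (j \in J); case: (j < i)%N; rewrite /= ?mulr1 ?mul1r.
Qed.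

Lemma kappa_toggle i J : kappa (toggle i J) = (-1) ^+ i * kappa J.
Proof.
rewrite /kappa (bigD1 i) //= [in RHS](bigD1 i) //= mulrA; congr (_ * _); last first.
  by apply: eq_bigr => k /negbTE kj; rewrite in_toggle kj.
rewrite in_toggle eqxx /=; case: (i \in J); rewrite ?mulr1 //.
by rewrite -expr2 sqrr_sign.
Qed.

(** Toggling i multiplies [kappa] by (-1)^i. So does passing from the wedge sign of a set to that of
    its complement, because each j < i lies in exactly one of the two. The signs cancel. *)
Lemma pairing_op p s t : pairing (op p s) t = pairing s (op p t).
Proof.
rewrite /pairing (reindex_inj (inv_inj (toggleK p.2))); apply: eq_bigr => J _.
rewrite !ffunE in_toggle eqxx inE toggleK toggle_setC kappa_toggle wedge_sign_toggle ltnn mul1r /=.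
case: eqP => _; last by rewrite mul0r !mulr0.
have h := wedge_sign_sqr p.2 J; rewrite -(wedge_signC p.2 J).
by rewrite -[RHS]mul1r -[X in _ = X * _]h; ring.
Qed.

Lemma pairing_clifford v s t : pairing (clifford v s) t = pairing s (clifford v t).
Proof.
transitivity (\sum_p vcoef v p * pairing (op p s) t).
  rewrite /pairing; under [RHS]eq_bigr => p _ do rewrite mulr_sumr.
  rewrite exchange_big; apply: eq_bigr => I _; rewrite cliffordE mulr_suml mulr_sumr.
  by apply: eq_bigr => p _; ring.
under eq_bigr => p _ do rewrite pairing_op.
rewrite /pairing; under eq_bigr => p _ do rewrite mulr_sumr.
rewrite exchange_big; apply: eq_bigr => I _; rewrite cliffordE !mulr_sumr.
by apply: eq_bigr => p _; ring.
Qed.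

Definition casimir s t s' t' : F := \sum_p pairing s (op p t) * pairing s' (op (dual p) t').

(* For Q v = 1 the operator op p becomes, after conjugation by v, its image under
   minus the reflection in v; the Casimir sum over a basis and the dual basis
   does not see this change of basis. *)
Lemma casimir_clifford v s t s' t' : Q v = 1 ->
  casimir (clifford v s) (clifford v t) (clifford v s') (clifford v t')
    = casimir s t s' t'.
Proof.
move=> Qv; rewrite /casimir.
have h p a b : pairing (clifford v a) (op p (clifford v b)) =
    vcoef v (dual p) * pairing a (clifford v b) - pairing a (op p b).
  rewrite pairing_clifford /pairing mulr_sumr -sumrB; apply: eq_bigr => I _.
  by rewrite clifford_sandwich //; ring.
under eq_bigr => p _ do rewrite !h dualK.
set x := pairing s _; set y := pairing s' _.
have hs a b : \sum_p vcoef v p * pairing a (op p b) = pairing a (clifford v b).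
  rewrite /pairing; under eq_bigr => p _ do rewrite mulr_sumr.
  rewrite exchange_big; apply: eq_bigr => I _; rewrite cliffordE !mulr_sumr.
  by apply: eq_bigr => p _; ring.
transitivity (\sum_p (x * y * (vcoef v p * vcoef v (dual p))
   - y * (vcoef v p * pairing s (op p t))
   - x * (vcoef v (dual p) * pairing s' (op (dual p) t'))
   + pairing s (op p t) * pairing s' (op (dual p) t'))).
  by apply: eq_bigr => p _; ring.
(* As Q v = 1, the first three sums are 2xy, xy and xy, and they cancel. *)
rewrite big_split sumrB sumrB -!mulr_sumr sum_vcoef Qv hs.
rewrite -(reindex_inj (inv_inj dualK) (P := xpredT)
  (F := fun p => vcoef v p * pairing s' (op p t'))) hs -/x -/y /=.
by rewrite -[RHS]add0r; congr (_ + _); ring.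
Qed.

Lemma casimir_Spin g s t s' t' : in_Spin g ->
  casimir (g s) (g t) (g s') (g t') = casimir s t s' t'.
Proof.
case=> vs [_ hQ gE]; rewrite !gE {gE}; elim: vs hQ => //= v vs IH hQ.
rewrite casimir_clifford; last by apply: hQ; rewrite mem_head.
by apply: IH => w ws; apply: hQ; rewrite inE ws orbT.
Qed.

End Clifford.

(** * Even spinors and the coordinates of S^+ *)

Section HalfSpinors.
Variable F : numFieldType.
Implicit Types (s t : spinor F) (p : bool * 'I_5) (k l : 'I_16).

Local Notation delta k := (spinor_basis F (half_set k)).

Lemma in_half_set k (i : 'I_5) : (i \in half_set k) = (i.+1 \in nth [::] half_labels k).
Proof. by rewrite inE. Qed.

Lemma half_set_inj : injective half_set.
Proof.
move=> k l /setP e; apply: val_inj.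
have {e} e i : (i < 5)%N ->
    (i.+1 \in nth [::] half_labels k) = (i.+1 \in nth [::] half_labels l).
  by move=> i5; rewrite -!(in_half_set _ (Ordinal i5)) e.
move: (e 0%N isT) (e 1%N isT) (e 2%N isT) (e 3%N isT) (e 4%N isT) => {e}.
by case: k => -[|[|[|[|[|[|[|[|[|[|[|[|[|[|[|[|]]]]]]]]]]]]]]]] //= _;
   case: l => -[|[|[|[|[|[|[|[|[|[|[|[|[|[|[|[|]]]]]]]]]]]]]]]].
Qed.

Lemma odd_card5 (I : {set 'I_5}) : odd #|I| = \big[addb/false]_(i < 5) (i \in I).
Proof.
rewrite -sum1_card (big_morph odd oddD (erefl : odd 0 = false)) big_mkcond.
by apply: eq_bigr => i _; case: (i \in I).
Qed.

Lemma half_set_even k : ~~ odd #|half_set k|.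
Proof.
rewrite odd_card5 !big_ord_recl big_ord0 !in_half_set /=.
by case: k => -[|[|[|[|[|[|[|[|[|[|[|[|[|[|[|[|]]]]]]]]]]]]]]]].
Qed.

Lemma odd_card_toggle i (I : {set 'I_5}) : odd #|toggle i I| = ~~ odd #|I|.
Proof.
rewrite !odd_card5 (bigD1 i) //= [in RHS](bigD1 i) //= in_toggle eqxx /= -addNb.
by congr (_ (+) _); apply: eq_bigr => j /negbTE ji; rewrite in_toggle ji.
Qed.

(** By counting: toggling one label matches even subsets with odd ones, so 16 of the 32 subsets are
    even, as many as the injective [half_set] reaches. *)
Lemma half_setP (I : {set 'I_5}) : ~~ odd #|I| -> exists k, I = half_set k.
Proof.
move=> evI; suff /imsetP[k _ ->] : I \in half_set @: setT by exists k.
pose ev := [set J : {set 'I_5} | ~~ odd #|J|].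
suff -> : half_set @: setT = ev by rewrite inE.
apply/eqP; rewrite eqEcard; apply/andP; split.
  by apply/subsetP => _ /imsetP[k _ ->]; rewrite inE half_set_even.
rewrite card_imset ?cardsT ?card_ord; last exact: half_set_inj.
have evC : #|~: ev| = #|ev|.
  rewrite -(card_imset _ (inv_inj (toggleK ord0))); apply: eq_card => J; rewrite !inE.
  apply/imsetP/idP => [[K]|evJ]; first by rewrite !inE => oK ->; rewrite odd_card_toggle.
  by exists (toggle ord0 J); rewrite ?toggleK // !inE odd_card_toggle evJ.
have := cardsC ev; rewrite evC -cardsT -powersetT card_powerset cardsT card_ord addnn => e.
by rewrite -leq_double e.
Qed.

Lemma clifford_parity v s c : (forall I : {set 'I_5}, odd #|I| = c -> s I = 0) ->
  forall I : {set 'I_5}, odd #|I| = ~~ c -> clifford v s I = 0.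
Proof.
move=> hs I oI; rewrite cliffordE big1 // => p _.
by rewrite ffunE hs ?mulr0 ?if_same ?mulr0 // odd_card_toggle oI negbK.
Qed.

Lemma Spin_parity g s : in_Spin g -> (forall I : {set 'I_5}, odd #|I| -> s I = 0) ->
  forall I : {set 'I_5}, odd #|I| -> g s I = 0.
Proof.
case=> vs [evs _ gE] hs I oI; rewrite gE.
have h : forall J : {set 'I_5}, odd #|J| = ~~ odd (size vs) -> foldr (@clifford F) s vs J = 0.
  elim: vs {evs gE} => [|v vs IH] //= J oJ.
  exact: clifford_parity IH _ _.
by apply: h; rewrite oI evs.
Qed.

Definition half_spinor (v : 'cV[F]_16) : spinor F :=
  [ffun I => \sum_k v k 0 * delta k I].

Lemma half_spinor_delta k : half_spinor (col k 1%:M) = delta k.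
Proof.
apply/ffunP => I; rewrite ffunE (bigD1 k) //= !mxE eqxx mul1r big1 ?addr0 // => l lk.
by rewrite !mxE (negbTE lk) mul0r.
Qed.

(** [half_spin_mx] records only even coordinates. The even number of factors of g makes the odd ones
    vanish, so the columns determine the images completely. *)
Lemma Spin_half_spinor g l : in_Spin g ->
  g (delta l) = half_spinor (col l (half_spin_mx g)).
Proof.
move=> Sg; apply/ffunP => I; rewrite ffunE.
case: (boolP (odd #|I|)) => [oI | /half_setP[k ->]].
  rewrite (Spin_parity Sg) //.
    rewrite big1 // => k _; rewrite ffunE; case: eqP => [e|]; last by rewrite mulr0.
    by move: oI; rewrite e (negbTE (half_set_even k)).
  move=> J oJ; rewrite ffunE; case: eqP => // e.
  by move: oJ; rewrite e (negbTE (half_set_even l)).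
rewrite (bigD1 k) //= ffunE eqxx mulr1 !mxE big1 ?addr0 // => m mk.
by rewrite ffunE (inj_eq half_set_inj) eq_sym (negbTE mk) mulr0.
Qed.

Definition qform p (u v : 'cV[F]_16) : F := pairing (half_spinor u) (op p (half_spinor v)).

Lemma pairing_suml (I : finType) (c : I -> F) (s_ : I -> spinor F) s t :
  (forall K, s K = \sum_k c k * s_ k K) -> pairing s t = \sum_k c k * pairing (s_ k) t.
Proof.
move=> sE; rewrite /pairing; under [RHS]eq_bigr => k _ do rewrite mulr_sumr.
rewrite exchange_big; apply: eq_bigr => K _; rewrite sE mulr_suml mulr_sumr.
by apply: eq_bigr => k _; ring.
Qed.

Lemma pairing_sumr (I : finType) (c : I -> F) (t_ : I -> spinor F) s t :
  (forall K, t K = \sum_k c k * t_ k K) -> pairing s t = \sum_k c k * pairing s (t_ k).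
Proof.
move=> tE; rewrite /pairing; under [RHS]eq_bigr => k _ do rewrite mulr_sumr.
rewrite exchange_big; apply: eq_bigr => K _; rewrite tE !mulr_sumr.
by apply: eq_bigr => k _; ring.
Qed.

Lemma qformE p u v :
  qform p u v = \sum_k \sum_l u k 0 * v l 0 * pairing (delta k) (op p (delta l)).
Proof.
rewrite /qform (pairing_suml (c := fun k => u k 0) (s_ := fun k => delta k)); last first.
  by move=> K; rewrite ffunE.
apply: eq_bigr => k _; rewrite (pairing_sumr (c := fun l => v l 0)
  (t_ := fun l => op p (delta l))); last by apply: op_sum => K; rewrite ffunE.
by rewrite mulr_sumr; apply: eq_bigr => l _; rewrite mulrA.
Qed.

End HalfSpinors.

(** * The 4-tensor theta in coordinates *)

Notation slot k := (@Ordinal 4 k isT).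

Lemma sum_ffun4 (T : finType) (V : nmodType) (G : T -> T -> T -> T -> V) :
  \sum_(x : {ffun 'I_4 -> T}) G (x (slot 0)) (x (slot 1)) (x (slot 2)) (x (slot 3))
    = \sum_a \sum_b \sum_c \sum_d G a b c d.
Proof.
rewrite pair_bigA pair_bigA pair_bigA /=.
pose h (z : T * T * T * T) : {ffun 'I_4 -> T} :=
  [ffun i : 'I_4 => match val i with 0 => z.1.1.1 | 1 => z.1.1.2 | 2 => z.1.2 | _ => z.2 end].
rewrite (reindex h); first by apply: eq_bigr => z _; rewrite !ffunE.
apply: onW_bij; exists (fun x : {ffun 'I_4 -> T} => (x (slot 0), x (slot 1), x (slot 2), x (slot 3))).
  by move=> [[[a b] c] d]; rewrite !ffunE.
move=> x; apply/ffunP => -[[|[|[|[|m]]]] lti] //; rewrite ffunE /=; congr (x _); exact: val_inj.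
Qed.

Section Theta.
Variable F : numFieldType.
Implicit Types (g : spinor F -> spinor F).

Definition theta n (A : 'M[F]_(16, n)) (y : {ffun 'I_4 -> 'I_n}) : F :=
  \sum_p qform p (col (y (slot 0)) A) (col (y (slot 1)) A)
          * qform (dual p) (col (y (slot 2)) A) (col (y (slot 3)) A).

(** Multilinearity in the four slots, written over all index maps so that it can be multiplied over
    seven quadruples. *)
Lemma theta_subst n (A : 'M[F]_(16, n)) (y : {ffun 'I_4 -> 'I_n}) :
  \sum_(x : {ffun 'I_4 -> 'I_16}) theta 1%:M x * \prod_s A (x s) (y s) = theta A y.
Proof.
pose G a b c d := theta 1%:M [ffun i : 'I_4 => nth a [:: a; b; c; d] i] *
  (A a (y (slot 0)) * A b (y (slot 1)) * A c (y (slot 2)) * A d (y (slot 3))).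
transitivity (\sum_a \sum_b \sum_c \sum_d G a b c d).
  rewrite -sum_ffun4; apply: eq_bigr => x _; congr (_ * _).
    by congr theta; apply/ffunP => -[[|[|[|[|m]]]] lti] //; rewrite ffunE /=;
      congr (x _); exact: val_inj.
  rewrite !big_ord_recl big_ord0 mulr1 !mulrA.
  by congr (_ * _ * _ * _); congr (A (x _) (y _)); apply: val_inj.
have [q qE qfE] : exists2 q, (forall p a b, q p a b = qform p (col a 1%:M) (col b 1%:M))
    & forall p (u v : 'cV[F]_16), qform p u v = \sum_k \sum_l u k 0 * v l 0 * q p k l.
  exists (fun p a b => qform p (col a 1%:M) (col b 1%:M)) => // p u v.
  by rewrite qformE /qform; do 2!apply: eq_bigr => ? _; rewrite !half_spinor_delta.
transitivity (\sum_p \sum_a \sum_b \sum_c \sum_d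
    (A a (y (slot 0)) * A b (y (slot 1)) * q p a b) *
    (A c (y (slot 2)) * A d (y (slot 3)) * q (dual p) c d)).
  do 4![rewrite [RHS]exchange_big; apply: eq_bigr => ? _].
  rewrite /G /theta mulr_suml; apply: eq_bigr => p _.
  by rewrite !qE !ffunE /=; ring.
apply: eq_bigr => p _; rewrite !qfE mulr_suml; apply: eq_bigr => a _.
rewrite mulr_suml; apply: eq_bigr => b _; rewrite mulr_sumr; apply: eq_bigr => c _.
by rewrite mulr_sumr; apply: eq_bigr => d _; rewrite !mxE.
Qed.

Lemma theta_Spin g y : in_Spin g -> theta (half_spin_mx g) y = theta 1%:M y.
Proof.
move=> Sg; rewrite /theta /qform -!(Spin_half_spinor _ Sg) !half_spinor_delta.
exact: casimir_Spin.
Qed.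

End Theta.

(** * Minors and alternating 7-tensors *)

Section Minors.
Variable R : comNzRingType.
Implicit Types (K L : {ffun 'I_7 -> 'I_16}) (k l : 'I_wedge_dim).

Lemma mindex_lt k (a b : 'I_7) : (a < b)%N -> (mindex k a < mindex k b)%N.
Proof. by move=> ab; move/forallP/(_ a)/forallP/(_ b)/implyP: (valP (enum_val k)); apply. Qed.

Lemma mindex_inj k : injective (mindex k).
Proof.
move=> a b e; apply: val_inj; case: (ltngtP a b) => // /(mindex_lt k);
  by rewrite e ltnn.
Qed.

Lemma mindex_sorted k : sorted ltn [seq val (mindex k a) | a <- enum 'I_7].
Proof.
rewrite sorted_map; apply: (@sub_sorted _ (relpre val ltn)).
  by move=> a b; apply: mindex_lt.
by rewrite -sorted_map val_enum_ord iota_ltn_sorted.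
Qed.

Lemma mindex_eq k l : (forall a, exists b, mindex k a = mindex l b) -> k = l.
Proof.
move=> h; apply: enum_val_inj; apply: val_inj; apply/ffunP => a; apply: val_inj.
pose s m := [seq val (mindex m a) | a <- enum 'I_7].
have us m : uniq (s m) by rewrite map_inj_uniq ?enum_uniq //; apply: inj_comp (@mindex_inj m); exact: val_inj.
have ss : {subset s k <= s l}.
  move=> _ /mapP[b _ ->]; have [c ->] := h b; apply/mapP; exists c => //.
  by rewrite mem_enum.
have [_ e] := uniq_min_size (us k) ss (eq_leq (etrans (size_map _ _) (esym (size_map _ _)))).
have nth_s m : nth 0%N (s m) a = mindex m a.
  by rewrite (nth_map a) ?size_enum_ord // nth_ord_enum.
rewrite -[LHS](nth_s k) -[RHS](nth_s l); congr nth.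
by apply: (irr_sorted_eq ltn_trans ltnn); rewrite ?mindex_sorted.
Qed.

(** The sorting permutation sends a to the number of values of K below [K a]; injectivity of K makes
    these numbers distinct. *)
Lemma mindexP K : injective K -> exists k (s : 'S_7), forall a, K a = mindex k (s a).
Proof.
move=> Kinj; pose S a := [set c | (K c < K a)%N].
have S7 a : (#|S a| < 7)%N.
  rewrite -[X in (_ < X)%N]card_ord -cardsT; apply: proper_card.
  by apply/properP; split=> //; exists a => //; rewrite inE ltnn.
pose f a := Ordinal (S7 a).
have f_lt a b : (K a < K b)%N -> (f a < f b)%N.
  move=> ab; apply: proper_card; apply/properP; split.
    by apply/subsetP => c; rewrite !inE => /ltn_trans; apply.
  by exists a; rewrite inE ?ab ?ltnn.
have finj : injective f.
  move=> a b e; apply: Kinj; apply: val_inj; case: (ltngtP (K a) (K b)) => // /f_lt;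
    by rewrite e ltnn.
pose s := perm finj; pose M := [ffun a => K ((s^-1)%g a)].
have M_lt : [forall a : 'I_7, forall b : 'I_7, (a < b)%N ==> (M a < M b)%N].
  apply/forallP => a; apply/forallP => b; apply/implyP => ab; rewrite !ffunE ltnNge.
  apply: contraL ab; rewrite -leqNgt leq_eqVlt => /orP[/eqP e|/f_lt].
    by have /perm_inj -> := Kinj _ _ (val_inj e).
  by rewrite -!(permE finj) !permKV; apply: ltnW.
exists (enum_rank (exist _ M M_lt)), s => a.
by rewrite /mindex enum_rankK /= ffunE permK.
Qed.

Lemma det_mxsub_perm m n (B : 'M[R]_(m, n)) (f f' : 'I_7 -> 'I_m) (g : 'I_7 -> 'I_n) (s : 'S_7) :
  (forall a, f a = f' (s a)) -> \det (mxsub f g B) = (-1) ^+ s * \det (mxsub f' g B).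
Proof.
move=> e; rewrite -det_perm -det_mulmx -row_permE; congr (\det _).
by apply/matrixP => a c; rewrite !mxE e.
Qed.

(** The minor of the identity is the signature of the sorting permutation if K sorts to [mindex k],
    and 0 otherwise. If K has a repetition, every minor with rows K vanishes. *)
Lemma minor_sort n (B : 'M[R]_(16, n)) (g : 'I_7 -> 'I_n) K :
  \sum_k \det (mxsub K (mindex k) 1%:M) * \det (mxsub (mindex k) g B) = \det (mxsub K g B).
Proof.
case: (boolP (injectiveb K)) => [/injectiveP/mindexP[k0 [s Ks]] | /injectivePn[a [b ab Kab]]].
  rewrite (det_mxsub_perm _ _ Ks) (bigD1 k0) //= (det_mxsub_perm _ _ Ks).
  have -> : mxsub (mindex k0) (mindex k0) 1%:M = 1%:M :> 'M[R]_7.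
    by apply/matrixP => a c; rewrite !mxE (inj_eq (@mindex_inj k0)).
  rewrite det1 mulr1 big1 ?addr0 // => k kk0; rewrite (det_mxsub_perm _ _ Ks).
  suff -> : \det (mxsub (mindex k0) (mindex k) 1%:M) = 0 :> R by rewrite mulr0 mul0r.
  have /existsP[a /forallP ha] : [exists a, forall b, mindex k0 a != mindex k b].
    apply: contraNT kk0 => h; apply/eqP/esym/mindex_eq => a.
    move: h; rewrite negb_exists => /forallP/(_ a); rewrite negb_forall => /existsP[b].
    by rewrite negbK => /eqP; exists b.
  rewrite (expand_det_row _ a) big1 // => b _.
  by rewrite !mxE (negbTE (ha b)) mul0r.
have det0 p (C : 'M[R]_(16, p)) h : \det (mxsub K h C) = 0.
  by apply: (determinant_alternate ab) => c; rewrite !mxE Kab.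
by rewrite det0 big1 // => k _; rewrite det0 mul0r.
Qed.

(** Multilinearity in the rows, that is Cauchy-Binet before the maps L are grouped by image.
    Products of entries of A remain, the form in which a tensor is transformed slot by slot. *)
Lemma det_mxsub_mul m n p (A : 'M[R]_(m, n)) (B : 'M[R]_(n, p)) (f : 'I_7 -> 'I_m) (g : 'I_7 -> 'I_p) :
  \det (mxsub f g (A *m B)) =
    \sum_(L : {ffun 'I_7 -> 'I_n}) \prod_a A (f a) (L a) * \det (mxsub L g B).
Proof.
rewrite /determinant; under [RHS]eq_bigr => L _ do rewrite mulr_sumr.
rewrite exchange_big; apply: eq_bigr => s _ /=.
transitivity ((-1) ^+ s * \prod_a \sum_l A (f a) l * B l (g (s a))).
  by congr (_ * _); apply: eq_bigr => a _; rewrite !mxE.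
rewrite bigA_distr_bigA mulr_sumr; apply: eq_bigr => L _.
rewrite big_split /= mulrCA; congr (_ * (_ * _)).
by apply: eq_bigr => a _; rewrite !mxE.
Qed.

(* Coordinates of w as an alternating tensor, indexed by arbitrary maps. *)
Definition alt_coord (w : 'cV[R]_wedge_dim) K : R :=
  \sum_k \det (mxsub K (mindex k) 1%:M) * w k 0.

Lemma alt_coord_scale c w K : alt_coord (c *: w) K = c * alt_coord w K.
Proof. by rewrite /alt_coord mulr_sumr; apply: eq_bigr => k _; rewrite mxE mulrCA. Qed.

End Minors.

Section MinorsField.
Variable F : fieldType.

(** On alternating tensors the seventh exterior power of A acts as its seventh tensor power. *)
Lemma alt_coord_wedge7 (A : 'M[F]_16) w K :
  alt_coord (wedge7_mx A *m w) K
    = \sum_(L : {ffun 'I_7 -> 'I_16}) \prod_a A (K a) (L a) * alt_coord w L.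
Proof.
transitivity (\sum_l \det (mxsub K (mindex l) A) * w l 0).
  under [RHS]eq_bigr => l _ do rewrite -minor_sort mulr_suml.
  rewrite exchange_big; apply: eq_bigr => k _; rewrite !mxE mulr_sumr.
  by apply: eq_bigr => l _; rewrite !mxE mulrA.
under [RHS]eq_bigr => L _ do rewrite mulr_sumr.
rewrite exchange_big; apply: eq_bigr => l _; rewrite -{1}[A]mulmx1 det_mxsub_mul mulr_suml.
by apply: eq_bigr => L _; rewrite mulrA.
Qed.

Definition cols_mx (b : 7.-tuple 'cV[F]_16) : 'M[F]_(16, 7) := \matrix_(k, c) tnth b c k 0.

(** The Plucker point is the volume tensor of a 7-dimensional coordinate space, carried to S^+ by
    the matrix of b; this has the same shape as the action of a square matrix. *)
Lemma alt_coord_plucker b K :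
  alt_coord (plucker b) K
    = \sum_(L : {ffun 'I_7 -> 'I_7}) \prod_a cols_mx b (K a) (L a) * \det (mxsub L id 1%:M).
Proof.
rewrite -det_mxsub_mul mulmx1 -minor_sort; apply: eq_bigr => k _.
by rewrite !mxE; congr (_ * \det _); apply/matrixP => a c; rewrite !mxE.
Qed.

End MinorsField.

(* The 28 entries of four 7-tuples are read as seven quadruples: for r < 3 the
   quadruple r consists of the entries 2 r and 2 r + 1 of the first two tuples,
   for 3 <= r < 6 likewise with the last two tuples, and the quadruple 6 is made
   of the last entries of the four tuples. *)
Definition quad_row (r : 'I_7) (s : 'I_4) : 'I_4 :=
  inord (if r < 6 then (3 <= r) * 2 + odd s else s)%N.
Definition quad_pos (r : 'I_7) (s : 'I_4) : 'I_7 :=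
  inord (if r < 6 then 2 * (r %% 3) + s %/ 2 else 6)%N.
Definition tuple_quad (j : 'I_4) (a : 'I_7) : 'I_7 :=
  inord (if a < 6 then (j %/ 2) * 3 + a %/ 2 else 6)%N.
Definition tuple_slot (j : 'I_4) (a : 'I_7) : 'I_4 :=
  inord (if a < 6 then odd j + 2 * odd a else j)%N.

Lemma quadK r s :
  (tuple_quad (quad_row r s) (quad_pos r s), tuple_slot (quad_row r s) (quad_pos r s)) = (r, s).
Proof.
rewrite /tuple_quad /tuple_slot /quad_row /quad_pos.
by case: r => -[|[|[|[|[|[|[|r]]]]]]] // ltr; case: s => -[|[|[|[|s]]]] // lts;
  rewrite !inordK //; congr (_, _); apply: val_inj; rewrite /= inordK.
Qed.

Lemma tupleK j a :
  (quad_row (tuple_quad j a) (tuple_slot j a), quad_pos (tuple_quad j a) (tuple_slot j a)) = (j, a).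
Proof.
rewrite /tuple_quad /tuple_slot /quad_row /quad_pos.
by case: j => -[|[|[|[|j]]]] // ltj; case: a => -[|[|[|[|[|[|[|a]]]]]]] // lta;
  rewrite !inordK //; congr (_, _); apply: val_inj; rewrite /= inordK.
Qed.

Section Quads.
Variable T : finType.

Definition quads (K : {ffun 'I_4 -> {ffun 'I_7 -> T}}) : {ffun 'I_7 -> {ffun 'I_4 -> T}} :=
  [ffun r => [ffun s => K (quad_row r s) (quad_pos r s)]].

Definition tuples (x : {ffun 'I_7 -> {ffun 'I_4 -> T}}) : {ffun 'I_4 -> {ffun 'I_7 -> T}} :=
  [ffun j => [ffun a => x (tuple_quad j a) (tuple_slot j a)]].

Lemma quadsK : cancel quads tuples.
Proof.
by move=> K; apply/ffunP => j; apply/ffunP => a; rewrite !ffunE; have [-> ->] := tupleK j a.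
Qed.

Lemma tuplesK : cancel tuples quads.
Proof.
by move=> x; apply/ffunP => r; apply/ffunP => s; rewrite !ffunE; have [-> ->] := quadK r s.
Qed.

Lemma prod_quads (R : comPzSemiRingType) (f : 'I_4 -> 'I_7 -> R) :
  \prod_j \prod_a f j a = \prod_r \prod_s f (quad_row r s) (quad_pos r s).
Proof.
rewrite !pair_bigA.
pose h (z : 'I_7 * 'I_4) := (quad_row z.1 z.2, quad_pos z.1 z.2).
rewrite (reindex h) //; apply: onW_bij.
exists (fun z : 'I_4 * 'I_7 => (tuple_quad z.1 z.2, tuple_slot z.1 z.2)).
  by case=> r s; apply: quadK.
by case=> j a; apply: tupleK.
Qed.

End Quads.

(** * The quartic invariant polynomial *)

Section Invariant.
Variable F : numFieldType.
Implicit Types w : 'cV[F]_wedge_dim.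

Definition theta_prod n (A : 'M[F]_(16, n)) (K : {ffun 'I_4 -> {ffun 'I_7 -> 'I_n}}) : F :=
  \prod_r theta A (quads K r).

Lemma theta_prod_subst n (A : 'M[F]_(16, n)) (L : {ffun 'I_4 -> {ffun 'I_7 -> 'I_n}}) :
  \sum_(K : {ffun 'I_4 -> {ffun 'I_7 -> 'I_16}})
     theta_prod 1%:M K * \prod_j \prod_a A (K j a) (L j a) = theta_prod A L.
Proof.
rewrite /theta_prod; under [RHS]eq_bigr => r _ do rewrite -theta_subst.
rewrite bigA_distr_bigA (reindex (@quads _)) /=; last first.
  by apply: onW_bij; exists (@tuples _); [exact: quadsK | exact: tuplesK].
apply: eq_bigr => K _; rewrite big_split /= prod_quads; congr (_ * _).
by apply: eq_bigr => r _; apply: eq_bigr => s _; rewrite !ffunE.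
Qed.

Definition contraction n (A : 'M[F]_(16, n)) (u : {ffun 'I_7 -> 'I_n} -> F) : F :=
  \sum_(K : {ffun 'I_4 -> {ffun 'I_7 -> 'I_n}}) theta_prod A K * \prod_j u (K j).

(** The matrix A passes from the tensor u into theta. For the matrix of a spin element this yields
    invariance; for the columns of a basis it cuts the index range from 16 to 7. *)
Lemma contraction_subst n (A : 'M[F]_(16, n)) u c :
  (forall K : {ffun 'I_7 -> 'I_16}, u K = \sum_(L : {ffun 'I_7 -> 'I_n}) \prod_a A (K a) (L a) * c L) ->
  contraction 1%:M u = contraction A c.
Proof.
move=> uE; rewrite /contraction.
under [LHS]eq_bigr => K _.
  under eq_bigr => j _ do rewrite uE.
  rewrite bigA_distr_bigA mulr_sumr.
  under eq_bigr => L _ do rewrite big_split /= mulrA.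
  over.
rewrite exchange_big; apply: eq_bigr => L _.
by rewrite -theta_prod_subst mulr_suml.
Qed.

Definition invariant w : F := contraction 1%:M (alt_coord w).

Lemma invariant_Spin g w : in_Spin g ->
  invariant (wedge7_mx (half_spin_mx g) *m w) = invariant w.
Proof.
move=> Sg; rewrite /invariant (contraction_subst (alt_coord_wedge7 (half_spin_mx g) w)).
apply: eq_bigr => K _; congr (_ * _); apply: eq_bigr => r _.
exact: theta_Spin.
Qed.

Lemma invariant_plucker b :
  invariant (plucker b) = contraction (cols_mx b) (fun L => \det (mxsub L id 1%:M)).
Proof. exact: contraction_subst (alt_coord_plucker b). Qed.

Definition alt_poly (K : {ffun 'I_7 -> 'I_16}) : {mpoly F[wedge_dim]} :=
  \sum_k \det (mxsub K (mindex k) 1%:M) *: 'X_k.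

Definition invariant_poly : {mpoly F[wedge_dim]} :=
  \sum_(K : {ffun 'I_4 -> {ffun 'I_7 -> 'I_16}})
    theta_prod 1%:M K *: \prod_j alt_poly (K j).

Lemma evalW_invariant w : evalW invariant_poly w = invariant w.
Proof.
rewrite /evalW /invariant_poly raddf_sum; apply: eq_bigr => K _.
rewrite /= mevalZ rmorph_prod; congr (_ * _); apply: eq_bigr => j _.
rewrite raddf_sum; apply: eq_bigr => k _.
by rewrite /= mevalZ mevalXU.
Qed.

Lemma invariant_poly_homog : invariant_poly \is 4.-homog.
Proof.
apply: rpred_sum => K _; apply: rpredZ; rewrite !big_ord_recr big_ord0 /= mul1r.
have h j : alt_poly (K j) \is 1.-homog.
  by apply: rpred_sum => k _; apply: rpredZ; rewrite dhomogX /= mdeg1.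
by apply: (dhomogM (d := 3)) => //; apply: (dhomogM (d := 2)) => //; apply: (dhomogM (d := 1)).
Qed.

End Invariant.

(** * From a nonzero value of the invariant to semistability *)

Section Semistability.
Variable F : numFieldType.
Implicit Types (X b : 7.-tuple 'cV[F]_16) (w : 'cV[F]_wedge_dim).

Lemma invariant_scale c w : invariant (c *: w) = c ^+ 4 * invariant w.
Proof.
rewrite /invariant /contraction mulr_sumr; apply: eq_bigr => K _.
rewrite mulrCA; congr (_ * _).
under eq_bigr => j _ do rewrite alt_coord_scale.
by rewrite big_split /= prodr_const card_ord.
Qed.

Lemma pluckerE X k : plucker X k 0 = \det (mxsub (mindex k) id (cols_mx X)).
Proof. by rewrite mxE; congr (\det _); apply/matrixP => a c; rewrite !mxE. Qed.

Lemma plucker_mul X b (C : 'M[F]_7) : cols_mx X = cols_mx b *m C ->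
  plucker X = \det C *: plucker b.
Proof.
move=> e; apply/colP => k; rewrite [RHS]mxE !pluckerE e mulrC -det_mulmx; congr (\det _).
by apply/matrixP => a c; rewrite !mxE; apply: eq_bigr => j _; rewrite !mxE.
Qed.

Lemma plucker_free X : plucker X != 0 -> free X.
Proof.
move=> nz; apply/freeP => c Xc i; apply/eqP; apply: contraNT nz => ci.
apply/eqP/colP => k; rewrite pluckerE -det_tr [RHS]mxE; apply/eqP/det0P.
exists (\row_j c j); first by apply/rV0Pn; exists i; rewrite mxE.
apply/rowP => a; rewrite !mxE; move/colP/(_ (mindex k a)): Xc; rewrite summxE mxE => Xc.
by rewrite -[RHS]Xc; apply: eq_bigr => j _; rewrite !mxE (tnth_nth 0).
Qed.

(** One family X suffices. A nonzero value makes its Plucker vector nonzero, so X is free and, by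
    dimension, a basis. Writing X through another basis b shows that the value at X is the value at
    b times the fourth power of a determinant, so the latter is nonzero too. *)
Lemma semistable_of_tuple (P : {vspace 'cV[F]_16}) X :
  (forall i, tnth X i \in P) -> (\dim P <= 7)%N -> invariant (plucker X) != 0 ->
  Spin_semistable P.
Proof.
move=> XP dimP nz.
have nzX : plucker X != 0.
  apply: contraNneq nz => ->; rewrite -(scale0r 0) invariant_scale.
  by rewrite expr0n mul0r.
have bX : basis_of P X.
  rewrite basisEfree plucker_free // size_tuple dimP andbT.
  by apply/span_subvP => _ /tnthP[i ->].
split; first by rewrite -(span_basis bX) (eqnP (plucker_free nzX)) size_tuple.
exists 4%N, (invariant_poly F); split => //.
- exact: invariant_poly_homog.
- by move=> g Sg w; rewrite !evalW_invariant invariant_Spin.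
move=> b bP; rewrite evalW_invariant; apply: contraNneq nz => e.
pose C := \matrix_(j, c) coord b j (tnth X c).
rewrite (plucker_mul (b := b) (C := C)) ?invariant_scale ?e ?mulr0 //.
apply/matrixP => k c; rewrite !mxE {1}(coord_basis bP (XP c)) summxE.
by apply: eq_bigr => j _; rewrite !mxE mulrC !(tnth_nth 0).
Qed.

End Semistability.

(** * Exact arithmetic with integer polynomials and Vandermonde signs *)

Section ListPoly.
Variables (K : Type) (k0 : K) (add mul : K -> K -> K).

Fixpoint ladd (p q : seq K) : seq K :=
  match p, q with
  | [::], _ => q
  | _, [::] => p
  | a :: p', b :: q' => add a b :: ladd p' q'
  end.

(** An empty q is treated apart so that a product with the zero polynomial is again the empty list,
    not a list of zeros. *)
Definition lmul (p q : seq K) : seq K :=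
  if q is [::] then [::] else foldr (fun a r => ladd (map (mul a) q) (k0 :: r)) [::] p.

Variables (R : comNzRingType) (f : K -> R).
Hypotheses (f0 : f k0 = 0) (fD : forall a b, f (add a b) = f a + f b).
Hypothesis fM : forall a b, f (mul a b) = f a * f b.

Definition leval (x : R) (p : seq K) : R := foldr (fun a r => f a + x * r) 0 p.

Lemma leval_add x p q : leval x (ladd p q) = leval x p + leval x q.
Proof.
elim: p q => [|a p IH] [|b q] /=; rewrite ?add0r ?addr0 //.
by rewrite IH fD; ring.
Qed.

Lemma leval_mul x p q : leval x (lmul p q) = leval x p * leval x q.
Proof.
rewrite /lmul; case: q => [|b q]; first by rewrite mulr0.
set g := (X in foldr X); elim: p => [|a p IH]; first by rewrite mul0r.
rewrite -[foldr g _ _]/(ladd (map (mul a) (b :: q)) (k0 :: foldr g [::] p)) leval_add -[leval x (k0 :: _)]/(f k0 + x * leval x _) IH f0 add0r.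
suff -> (r : seq K) : leval x (map (mul a) r) = f a * leval x r by rewrite /=; ring.
by elim: r => [|c r IHr] /=; rewrite ?mulr0 // fM IHr; ring.
Qed.

End ListPoly.

(* Polynomials in two variables with integer coefficients, as lists of
   coefficients; the inner lists are polynomials in the first variable. *)
Definition zpoly := seq (seq Z).
Definition zadd : zpoly -> zpoly -> zpoly := ladd (ladd Z.add).
Definition zmul : zpoly -> zpoly -> zpoly := lmul [::] (ladd Z.add) (lmul Z0 Z.add Z.mul).
Definition zconst (z : Z) : zpoly := [:: [:: z]].
Definition zsum (T : Type) (f : T -> zpoly) (s : seq T) : zpoly :=
  foldr (fun a r => zadd (f a) r) [::] s.
Definition zis0 (p : zpoly) : bool := all (all (Z.eqb Z0)) p.

Section Eval.
Variable F : comNzRingType.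
Variables t d : F.

Definition zval (z : Z) : F := (int_of_Z z)%:~R.

Lemma zval_add x y : zval (Z.add x y) = zval x + zval y.
Proof. by rewrite /zval -intrD -rmorphD. Qed.

Lemma zval_mul x y : zval (Z.mul x y) = zval x * zval y.
Proof. by rewrite /zval -intrM -rmorphM. Qed.

Lemma zval_sub x y : zval (Z.sub x y) = zval x - zval y.
Proof. by rewrite /zval -intrB -rmorphB. Qed.

Lemma zval_nat n : zval (Z.of_nat n) = n%:R.
Proof. by rewrite /zval -[Z.of_nat n]/(Z_of_int n) Z_of_intK. Qed.

Definition zeval (p : zpoly) : F := leval (leval zval t) d p.

Lemma zeval_add p q : zeval (zadd p q) = zeval p + zeval q.
Proof. by apply: leval_add; apply: leval_add; apply: zval_add. Qed.

Lemma zeval_mul p q : zeval (zmul p q) = zeval p * zeval q.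
Proof.
apply: leval_mul => //; first by apply: leval_add; apply: zval_add.
by apply: leval_mul => //; [apply: zval_add | apply: zval_mul].
Qed.

Lemma zeval_const z : zeval (zconst z) = zval z.
Proof. by rewrite /zeval /= !mulr0 !addr0. Qed.

Lemma zeval_is0 p : zis0 p -> zeval p = 0.
Proof.
rewrite /zeval; elim: p => //= a p IH /andP[ha /IH ->]; rewrite mulr0 addr0.
elim: a ha => //= z a IHa /andP[z0 /IHa ->]; have <- := proj1 (Z.eqb_eq Z0 z) z0.
by rewrite mulr0 addr0.
Qed.

Lemma zeval_sum (T : Type) (f : T -> zpoly) (s : seq T) :
  zeval (zsum f s) = \sum_(a <- s) zeval (f a).
Proof. by elim: s => [|a s IH]; rewrite ?big_nil ?big_cons //= zeval_add IH. Qed.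

End Eval.

(* The Vandermonde product: up to a constant factor, the signature of s when s
   is a permutation of the first n natural numbers, and 0 when s has repetitions. *)
Fixpoint vdm (s : seq nat) : Z :=
  if s is x :: s' then foldr (fun y r => Z.mul (Z.sub (Z.of_nat y) (Z.of_nat x)) r) (vdm s') s'
  else Z.one.

Section Vandermonde.
Variable F : comNzRingType.
Local Notation zval := (zval F).

Lemma vdm_cons x s : zval (vdm (x :: s)) = (\prod_(y <- s) (y%:R - x%:R)) * zval (vdm s).
Proof.
rewrite [vdm _]/=; move: (vdm s) => z; elim: s => [|y s IH] /=.
  by rewrite big_nil mul1r.
by rewrite zval_mul IH big_cons zval_sub !zval_nat mulrA.
Qed.

Lemma vdm_swap s1 x y s2 :
  zval (vdm (s1 ++ x :: y :: s2)) = - zval (vdm (s1 ++ y :: x :: s2)).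
Proof.
elim: s1 => [|z s1 IH]; first by rewrite !cat0s !vdm_cons !big_cons; ring.
rewrite !cat_cons !vdm_cons IH mulrN; congr (- (_ * _)); apply: perm_big.
by rewrite perm_cat2l -!(cat1s _ (_ :: s2)) -!(cat1s _ s2) perm_catCA.
Qed.

Lemma vdm_notuniq s : ~~ uniq s -> zval (vdm s) = 0.
Proof.
elim: s => // x s IH; rewrite cons_uniq vdm_cons negb_and negbK => /orP[xs|/IH ->]; last exact: mulr0.
by rewrite (big_rem x) //= subrr !mul0r.
Qed.

Lemma vdmE s :
  zval (vdm s) = \prod_(i < size s) \prod_(j < size s | (i < j)%N) ((nth 0 s j)%:R - (nth 0 s i)%:R).
Proof.
elim: s => [|x s IH]; first by rewrite big_ord0.
rewrite vdm_cons IH /= big_ord_recl; congr (_ * _).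
  by rewrite [RHS]big_mkcond big_ord_recl /= mul1r (big_nth 0%N) big_mkord.
apply: eq_bigr => i _; rewrite [RHS]big_mkcond big_ord_recl /= mul1r big_mkcond.
by apply: eq_bigr.
Qed.

(** The Vandermonde matrix at the values of L is the one at 0, ..., n-1 times the 0-1 matrix of L.
    The sign of L thus becomes a plain integer product. *)
Lemma vdm_det n (L : {ffun 'I_n -> 'I_n}) :
  zval (vdm [seq val (L a) | a <- enum 'I_n])
    = zval (vdm (iota 0 n)) * \det (mxsub L id 1%:M).
Proof.
have h (f : 'I_n -> nat) : zval (vdm [seq f a | a <- enum 'I_n]) =
    \det (Vandermonde n (\row_j (f j)%:R : 'rV[F]_n)).
  have nthE (i : 'I_n) : nth 0%N [seq f a | a <- enum 'I_n] i = f i.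
    by rewrite (nth_map i) ?size_enum_ord // nth_ord_enum.
  rewrite vdmE det_Vandermonde size_map size_enum_ord.
  by apply: eq_bigr => i _; apply: eq_bigr => j _; rewrite !mxE !nthE.
have e : iota 0 n = [seq val a | a <- enum 'I_n] by rewrite val_enum_ord.
rewrite e !h -[X in _ * X]det_tr -det_mulmx; congr (\det _).
apply/matrixP => i j; rewrite !mxE (bigD1 (L j)) //= !mxE eqxx mulr1 big1 ?addr0 // => c cL.
by rewrite !mxE eq_sym (negbTE cL) mulr0.
Qed.

End Vandermonde.

(** * Computable forms of the pairing and of theta *)

Definition half_mem (k j : nat) : bool := j.+1 \in nth [::] half_labels k.

(* The pairing of e_K with the image of e_L under e_(i+1) or e_-(i+1), where K and L
   are the sets of rank k and l. *)
Definition qcoef (b : bool) (i k l : nat) : Z :=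
  if ((~~ half_mem k i) == b) &&
     all (fun j => half_mem l j == (j == i) (+) ~~ half_mem k j) (iota 0 5)
  then (if odd (sumn [seq half_mem k j * j + (~~ half_mem k j && (j < i)) | j <- iota 0 5])
        then Zneg xH else Zpos xH)%N
  else Z0.

Section Coefficients.
Variable F : numFieldType.

Lemma all_iotaP n (P : pred nat) : reflect (forall i : 'I_n, P i) (all P (iota 0 n)).
Proof.
apply: (iffP allP) => h i; first by apply: h; rewrite mem_iota leq0n add0n ltn_ord.
by rewrite mem_iota add0n => lti; apply: (h (Ordinal lti)).
Qed.

(** A single set contributes. Its sign joins [kappa], with exponent j for each j in the set, to
    [wedge_sign] on the complement, with exponent 1 for each j < i outside the set. *)
Lemma pairing_delta b (i : 'I_5) k l :
  pairing (spinor_basis F (half_set k)) (op (b, i) (spinor_basis F (half_set l)))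
    = zval F (qcoef b i k l).
Proof.
rewrite /pairing (bigD1 (half_set k)) //= big1 ?addr0 => [|I Ik]; last first.
  by rewrite ffunE (negbTE Ik) mul0r mulr0.
rewrite !ffunE eqxx mul1r inE in_half_set /= -/(half_mem k i) /qcoef.
case: eqP => _; rewrite ?andTb ?andFb; last by rewrite mulr0.
have -> : (toggle i (~: half_set k) == half_set l)
    = all (fun j => half_mem l j == (j == i) (+) ~~ half_mem k j) (iota 0 5).
  apply/eqP/all_iotaP => [e j | h].
    by rewrite /half_mem -!in_half_set -e in_toggle inE.
  apply/setP => j; rewrite in_toggle inE !in_half_set.
  by rewrite -[_ \in nth _ _ l]/(half_mem l j) (eqP (h j)).
case: (all _ _); last by rewrite /zval !mulr0.
rewrite mulr1 /kappa wedge_signE -big_split.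
transitivity ((-1 : F) ^+ \sum_(j < 5) (half_mem k j * j + (~~ half_mem k j && (j < i)))%N).
  rewrite -prodrXr; apply: eq_bigr => j _; rewrite in_setC in_half_set -/(half_mem k j).
  by case: (half_mem k j); case: (j < i)%N; rewrite /= ?mul1n ?addn0 ?mulr1 ?mul1r.
rewrite sumnE big_map -[iota 0 5]/(index_iota 0 5) big_mkord -signr_odd.
by case: odd.
Qed.

End Coefficients.
Definition zvector := seq (seq nat * zpoly).

Definition zcoord (v : zvector) (k : nat) : zpoly :=
  zsum (fun u => if nth [::] half_labels k == u.1 then u.2 else [::]) v.

Definition qcoefs (b : bool) (i : nat) : seq (nat * nat * Z) :=
  [seq u <- [seq (k, l, qcoef b i k l) | k <- iota 0 16, l <- iota 0 16] | ~~ Z.eqb u.2 Z0].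

Definition zqform (q : seq (nat * nat * Z)) (v w : seq zpoly) : zpoly :=
  zsum (fun u => zmul (zconst u.2) (zmul (nth [::] v u.1.1) (nth [::] w u.1.2))) q.

Definition zentry (A : seq (seq zpoly)) (i j : nat) : zpoly := nth [::] (nth [::] A i) j.

Definition zgram (b : bool) (i : nat) (vs : seq (seq zpoly)) : seq (seq zpoly) :=
  let q := qcoefs b i in [seq [seq zqform q v w | w <- vs] | v <- vs].

Definition zgrams (vs : seq (seq zpoly)) : seq (seq (seq zpoly) * seq (seq zpoly)) :=
  [seq (zgram false i vs, zgram true i vs) | i <- iota 0 5].

Definition ztheta (g : seq (seq (seq zpoly) * seq (seq zpoly))) (i j k l : nat) : zpoly :=
  zsum (fun u => zadd (zmul (zentry u.1 i j) (zentry u.2 k l))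
                      (zmul (zentry u.2 i j) (zentry u.1 k l))) g.

Section Theta.
Variable F : numFieldType.
Variables t d : F.
Local Notation zeval := (zeval t d).

Definition vector_of (v : zvector) : 'cV[F]_16 := \sum_(u <- v) zeval u.2 *: e F u.1.

Lemma vector_ofE v (k : 'I_16) : vector_of v k 0 = zeval (zcoord v k).
Proof.
rewrite summxE zeval_sum; apply: eq_bigr => u _; rewrite !mxE.
by case: eqP => _; rewrite ?mulr1 ?mulr0.
Qed.

Lemma zqformE b (i : 'I_5) v w :
  zeval (zqform (qcoefs b i) (mkseq (zcoord v) 16) (mkseq (zcoord w) 16))
    = qform (b, i) (vector_of v) (vector_of w).
Proof.
rewrite zeval_sum big_filter qformE.
rewrite big_mkcond big_allpairs_dep -[iota 0 16]/(index_iota 0 16) big_mkord.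
apply: eq_bigr => k _; rewrite big_mkord; apply: eq_bigr => l _.
rewrite pairing_delta !vector_ofE /= !zeval_mul zeval_const !nth_mkseq //.
case: ifP => [_|/negbFE/Z.eqb_eq ->]; first by rewrite mulrC.
by rewrite /zval !mulr0.
Qed.

Definition tuple_of (vs : seq zvector) : 7.-tuple 'cV[F]_16 :=
  [tuple vector_of (nth [::] vs i) | i < 7].

Lemma zentry_gram b (i : 'I_5) vs (j k : 'I_7) : size vs = 7%N ->
  zeval (zentry (zgram b i [seq mkseq (zcoord v) 16 | v <- vs]) j k)
    = qform (b, i) (col j (cols_mx (tuple_of vs))) (col k (cols_mx (tuple_of vs))).
Proof.
move=> s7; have colE (l : 'I_7) : col l (cols_mx (tuple_of vs)) = vector_of (nth [::] vs l).
  by apply/colP => m; rewrite !mxE tnth_mktuple.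
rewrite !colE -zqformE /zentry /zgram !(nth_map [::]) ?size_map ?s7 //.
Qed.

Lemma zthetaE vs (x : {ffun 'I_4 -> 'I_7}) : size vs = 7%N ->
  zeval (ztheta (zgrams [seq mkseq (zcoord v) 16 | v <- vs])
           (x (slot 0)) (x (slot 1)) (x (slot 2)) (x (slot 3)))
    = theta (cols_mx (tuple_of vs)) x.
Proof.
move=> s7; rewrite zeval_sum /zgrams big_map -[iota 0 5]/(index_iota 0 5) big_mkord.
rewrite /theta sum_boolx; apply: eq_bigr => i _.
rewrite zeval_add [X in X + _]zeval_mul [X in _ + X]zeval_mul.
by congr (_ * _ + _ * _); apply: zentry_gram s7.
Qed.

End Theta.

(** * The matrix C as a computation in exterior powers *)

Definition increasing_pairs : seq (nat * nat) :=
  [seq u <- [seq (i, j) | i <- iota 0 7, j <- iota 0 7] | (u.1 < u.2)%N].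

(* An entry (s, u, c) stands for the term c times the wedge of the basis vectors
   with indices in s, tensored with the wedge of those with indices in u. *)
Definition zform := seq (seq nat * seq nat * zpoly).

Definition zalt (f : nat -> nat -> nat -> nat -> zpoly) : zform :=
  [seq u <- [seq ([:: p.1; p.2], [:: q.1; q.2],
      zadd (zadd (f p.1 q.1 p.2 q.2) (f p.2 q.2 p.1 q.1))
        (zmul (zconst (Zneg xH)) (zadd (f p.2 q.1 p.1 q.2) (f p.1 q.2 p.2 q.1))))
     | p <- increasing_pairs, q <- increasing_pairs] | ~~ zis0 u.2].

Definition zwedge (p q : zform) : zform :=
  [seq (u.1.1.1 ++ u.2.1.1, u.1.1.2 ++ u.2.1.2, zmul u.1.2 u.2.2)
     | u <- [seq (u, v) | u <- p, v <- q]
     & uniq (u.1.1.1 ++ u.2.1.1) && uniq (u.1.1.2 ++ u.2.1.2)].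

(** This is the entry C_ij: each side of an element of Lambda^6 tensor Lambda^6 is completed by one
    index, i or j, to a top form of the 7-space and read as a number, up to the Vandermonde
    constant. *)
Definition zcofactor (p : zform) (i j : nat) : zpoly :=
  zsum (fun u => if (i \in u.1.1) || (j \in u.1.2) then [::]
                 else zmul u.2 (zconst (Z.mul (vdm (rcons u.1.1 i)) (vdm (rcons u.1.2 j))))) p.

Definition zinvariant (vs : seq zvector) : zpoly :=
  let f := ztheta (zgrams [seq mkseq (zcoord v) 16 | v <- vs]) in
  let p := zalt f in
  let p3 := zwedge (zwedge p p) p in
  let c := mkseq (fun i => mkseq (zcofactor p3 i) 7) 7 in
  zsum (fun i => zsum (fun j => zsum (fun k => zsum (fun l =>
    zmul (f i j k l) (zmul (zentry c i j) (zentry c k l)))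
    (iota 0 7)) (iota 0 7)) (iota 0 7)) (iota 0 7).

Section Correctness.
Variable F : numFieldType.
Variables t d : F.
Local Notation zeval := (zeval t d).
Local Notation zval := (zval F).

Definition pair_form (p : zform) (phi : seq nat -> seq nat -> F) : F :=
  \sum_(u <- p) zeval u.2 * phi u.1.1 u.1.2.

Lemma sum_increasing_pairs (g : nat -> nat -> F) : (forall i, g i i = 0) ->
  \sum_(i < 7) \sum_(j < 7) g i j = \sum_(u <- increasing_pairs) (g u.1 u.2 + g u.2 u.1).
Proof.
move=> g0; rewrite [RHS]big_filter [RHS]big_mkcond [RHS]big_allpairs_dep -[iota 0 7]/(index_iota 0 7) big_mkord.
have -> : \sum_(i < 7) \sum_(j <- index_iota 0 7)
     (if (i < j)%N then g i j + g j i else 0) =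
   \sum_(i < 7) \sum_(j < 7) ((if (i < j)%N then g i j else 0) + (if (i < j)%N then g j i else 0)).
  apply: eq_bigr => i _; rewrite big_mkord; apply: eq_bigr => j _.
  by case: ifP; rewrite ?addr0.
under [RHS]eq_bigr => i _ do rewrite big_split.
rewrite big_split /= [X in _ + X]exchange_big -big_split; apply: eq_bigr => i _ /=.
rewrite -big_split; apply: eq_bigr => j _ /=.
by case: ltngtP => [||->]; rewrite ?addr0 ?add0r ?g0.
Qed.

(** An alternating [phi] allows the four orderings of two index pairs to be merged, with signs, into
    one coefficient on increasing pairs. Repeated indices contribute 0 because x = - x forces x = 0
    in characteristic 0. *)
Lemma pair_form_alt (f : nat -> nat -> nat -> nat -> zpoly) (phi : seq nat -> seq nat -> F) :
  (forall i j u, phi [:: i; j] u = - phi [:: j; i] u) ->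
  (forall i j s, phi s [:: i; j] = - phi s [:: j; i]) ->
  \sum_(i < 7) \sum_(j < 7) \sum_(k < 7) \sum_(l < 7) zeval (f i j k l) * phi [:: val i; val k] [:: val j; val l]
    = pair_form (zalt f) phi.
Proof.
move=> altl altr.
have phi0 (x : F) : x = - x -> x = 0.
  by move/eqP; rewrite -subr_eq0 opprK -mulr2n mulrn_eq0 /= => /eqP.
transitivity (\sum_(i < 7) \sum_(k < 7) \sum_(j < 7) \sum_(l < 7)
    zeval (f i j k l) * phi [:: val i; val k] [:: val j; val l]).
  by apply: eq_bigr => i _; rewrite exchange_big.
rewrite (sum_increasing_pairs (g := fun i k => \sum_(j < 7) \sum_(l < 7)
    zeval (f i j k l) * phi [:: i; k] [:: val j; val l])); last first.
  move=> i; apply: big1 => j _; apply: big1 => l _.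
  by rewrite (phi0 _ (altl i i _)) mulr0.
rewrite /pair_form [RHS]big_filter [RHS]big_mkcond. rewrite [RHS]big_allpairs_dep; apply: eq_bigr => p _.
rewrite !(sum_increasing_pairs (g := fun j l => zeval (f _ j _ l) * phi _ [:: j; l]));
  try by move=> j; rewrite (phi0 _ (altr j j _)) mulr0.
rewrite -big_split; apply: eq_bigr => q _ /=.
set z := zadd _ _; transitivity (zeval z * phi [:: p.1; p.2] [:: q.1; q.2]).
  rewrite /z !zeval_add zeval_mul zeval_const zeval_add.
  rewrite (altl p.2 p.1) (altl p.2 p.1) (altr q.2 q.1) -[zval _]/(- 1).
  by rewrite -[phi _ [:: q.1; q.2]]opprK; ring.
by case: ifP => // /negbFE z0; rewrite zeval_is0 // mul0r.
Qed.

Lemma pair_form_wedge p q (phi : seq nat -> seq nat -> F) :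
  (forall s u, ~~ (uniq s && uniq u) -> phi s u = 0) ->
  pair_form (zwedge p q) phi
    = pair_form p (fun s u => pair_form q (fun s' u' => phi (s ++ s') (u ++ u'))).
Proof.
move=> phi0; rewrite /pair_form big_map big_filter big_mkcond big_allpairs_dep.
apply: eq_bigr => e1 _; rewrite mulr_sumr; apply: eq_bigr => e2 _ /=.
rewrite zeval_mul; case: ifPn => [_|/phi0 ->]; first by rewrite mulrA.
by rewrite !mulr0.
Qed.

Lemma zcofactorE p i j :
  zeval (zcofactor p i j)
    = pair_form p (fun s u => zval (vdm (rcons s i)) * zval (vdm (rcons u j))).
Proof.
rewrite zeval_sum; apply: eq_bigr => e _; case: ifPn => [|_]; last first.
  by rewrite zeval_mul zeval_const zval_mul.
case/orP => h; rewrite /=.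
  by rewrite (vdm_notuniq F (s := rcons _ i)) ?mul0r ?mulr0 // rcons_uniq h.
by rewrite (vdm_notuniq F (s := rcons _ j)) ?mulr0 // rcons_uniq h.
Qed.

Lemma vdm_rcons_notuniq s i : ~~ uniq s -> zval (vdm (rcons s i)) = 0.
Proof. by move=> h; rewrite vdm_notuniq // rcons_uniq negb_and h orbT. Qed.

Lemma pair_form_opp p (phi psi : seq nat -> seq nat -> F) :
  (forall s u, phi s u = - psi s u) -> pair_form p phi = - pair_form p psi.
Proof. by move=> e; rewrite /pair_form -sumrN; apply: eq_bigr => u _; rewrite e mulrN. Qed.

Variable vs : seq zvector.
Hypothesis vs7 : size vs = 7%N.
Let A := cols_mx (tuple_of t d vs).
Let f := ztheta (zgrams [seq mkseq (zcoord v) 16 | v <- vs]).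
Let p := zalt f.

Lemma sum_theta_nat (phi : nat -> nat -> nat -> nat -> F) :
  \sum_(x : {ffun 'I_4 -> 'I_7}) theta A x * phi (x (slot 0)) (x (slot 1)) (x (slot 2)) (x (slot 3))
    = \sum_(i < 7) \sum_(j < 7) \sum_(k < 7) \sum_(l < 7) zeval (f i j k l) * phi i j k l.
Proof.
rewrite -(sum_ffun4 (fun i j k l : 'I_7 => zeval (f i j k l) * phi i j k l)).
by apply: eq_bigr => x _; rewrite (zthetaE t d x vs7).
Qed.

Lemma sum_theta_form (phi : seq nat -> seq nat -> F) :
  (forall i j u, phi [:: i; j] u = - phi [:: j; i] u) ->
  (forall i j s, phi s [:: i; j] = - phi s [:: j; i]) ->
  pair_form p phi = \sum_(x : {ffun 'I_4 -> 'I_7})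
    theta A x * phi [:: val (x (slot 0)); val (x (slot 2))] [:: val (x (slot 1)); val (x (slot 3))].
Proof.
move=> altl altr; rewrite -pair_form_alt //.
by rewrite (sum_theta_nat (fun i j k l => phi [:: i; k] [:: j; l])).
Qed.

(** The order is that of the positions in a 7-tuple: slots 0 and 2 of three quadruples fill the
    first tuple of a pair, slots 1 and 3 the second, and i is the last entry. *)
Definition signs (x y z : {ffun 'I_4 -> 'I_7}) (a : 'I_4) (b : 'I_4) (i : nat) : F :=
  zval (vdm [:: val (x a); val (x b); val (y a); val (y b); val (z a); val (z b); i]).

(** The three factors are unfolded one at a time. Each time the function being paired has to be
    alternating, which is the sign change of [vdm] under an adjacent transposition. *)
Lemma cofactor_sum i j :
  zeval (zcofactor (zwedge (zwedge p p) p) i j)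
    = \sum_x \sum_y \sum_z theta A x * (theta A y * (theta A z *
        (signs x y z (slot 0) (slot 2) i * signs x y z (slot 1) (slot 3) j))).
Proof.
rewrite zcofactorE !pair_form_wedge; last first.
- by move=> s u; rewrite negb_and => /orP[] h;
    rewrite (vdm_rcons_notuniq _ h) ?mul0r ?mulr0.
- move=> s u h; apply: big1 => e _.
  have {}h : ~~ uniq (s ++ e.1.1) || ~~ uniq (u ++ e.1.2).
    by rewrite !cat_uniq !negb_and; case/nandP: h => ->; rewrite ?orbT.
  by case/orP: h => h; rewrite (vdm_rcons_notuniq _ h) ?mul0r !mulr0.
rewrite sum_theta_form.
- apply: eq_bigr => x _; rewrite sum_theta_form.
  + rewrite mulr_sumr; apply: eq_bigr => y _; rewrite sum_theta_form.
    * by rewrite !mulr_sumr; apply: eq_bigr => z _; rewrite /signs.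
    * by move=> a b u; rewrite -!cats1 -!catA -mulNr; congr (_ * _); exact: (vdm_swap F [:: _; _; _; _]).
    * by move=> a b u; rewrite -!cats1 -!catA -mulrN; congr (_ * _); exact: (vdm_swap F [:: _; _; _; _]).
  + by move=> a b u; apply: pair_form_opp => s' u'; rewrite -!cats1 -!catA -mulNr; congr (_ * _); exact: (vdm_swap F [:: _; _]).
  + by move=> a b u; apply: pair_form_opp => s' u'; rewrite -!cats1 -!catA -mulrN; congr (_ * _); exact: (vdm_swap F [:: _; _]).
- by move=> a b u; apply: pair_form_opp => s u'; apply: pair_form_opp => s' u'';
    rewrite -!cats1 -!catA -mulNr; congr (_ * _); exact: (vdm_swap F [::]).
- by move=> a b u; apply: pair_form_opp => s u'; apply: pair_form_opp => s' u'';
    rewrite -!cats1 -!catA -mulrN; congr (_ * _); exact: (vdm_swap F [::]).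
Qed.

End Correctness.

(** * Factorization of the contraction into two halves *)

Notation entry r := (@Ordinal 7 r isT).

(** The last index is summed outermost because it stands for the quadruple linking the two
    halves. *)
Lemma sum_ffun7 (T : finType) (V : nmodType) (G : T -> T -> T -> T -> T -> T -> T -> V) :
  \sum_(x : {ffun 'I_7 -> T}) G (x (entry 0)) (x (entry 1)) (x (entry 2)) (x (entry 3))
      (x (entry 4)) (x (entry 5)) (x (entry 6))
    = \sum_g \sum_a \sum_b \sum_c \sum_d \sum_e \sum_f G a b c d e f g.
Proof.
rewrite !pair_bigA /=.
pose h (z : T * T * T * T * T * T * T) : {ffun 'I_7 -> T} :=
  [ffun i : 'I_7 => match val i with
     0 => z.1.1.1.1.1.2 | 1 => z.1.1.1.1.2 | 2 => z.1.1.1.2 | 3 => z.1.1.2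
   | 4 => z.1.2 | 5 => z.2 | _ => z.1.1.1.1.1.1 end].
rewrite (reindex h); first by apply: eq_bigr => z _; rewrite !ffunE.
apply: onW_bij; exists (fun x : {ffun 'I_7 -> T} => (x (entry 6), x (entry 0), x (entry 1),
  x (entry 2), x (entry 3), x (entry 4), x (entry 5))).
  by move=> [[[[[[g a] b] c] d] e] f]; rewrite !ffunE.
by move=> x; apply/ffunP => -[[|[|[|[|[|[|[|m]]]]]]] lti] //; rewrite ffunE /=;
  congr (x _); exact: val_inj.
Qed.

Section Evaluation.
Variable F : numFieldType.
Variables t d : F.
Local Notation zeval := (zeval t d).
Local Notation zval := (zval F).

Lemma map_enum7 (f : 'I_7 -> nat) :
  [seq f a | a <- enum 'I_7] = [:: f (entry 0); f (entry 1); f (entry 2); f (entry 3);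
     f (entry 4); f (entry 5); f (entry 6)].
Proof.
have <- : [seq f (inord i) | i <- iota 0 7] = [seq f a | a <- enum 'I_7].
  by rewrite -val_enum_ord -map_comp; apply: eq_map => a /=; rewrite inord_val.
rewrite /=; do ![congr (_ :: _)]; congr f; apply: val_inj; exact: inordK.
Qed.

Lemma tuplesE (x : {ffun 'I_7 -> {ffun 'I_4 -> 'I_7}}) (j : 'I_4) (a : 'I_7) r s :
  val (tuple_quad j a) = val r -> val (tuple_slot j a) = val s -> tuples x j a = x r s.
Proof. by move=> hr hs; rewrite !ffunE (val_inj hr) (val_inj hs). Qed.

Lemma prod_ord7 (f : 'I_7 -> F) : \prod_r f r = f (entry 0) * f (entry 1) * f (entry 2) *
  f (entry 3) * f (entry 4) * f (entry 5) * f (entry 6).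
Proof.
rewrite 7!big_ord_recl big_ord0 mulr1 !mulrA.
by congr (_ * _ * _ * _ * _ * _ * _); congr f; apply: val_inj.
Qed.

Lemma mul_sum3 (T : finType) (c : F) (u v : T -> T -> T -> F) :
  c * ((\sum_x \sum_y \sum_z u x y z) * (\sum_x \sum_y \sum_z v x y z))
    = \sum_x \sum_y \sum_z \sum_x' \sum_y' \sum_z' c * (u x y z * v x' y' z').
Proof.
rewrite mulr_suml mulr_sumr; apply: eq_bigr => x _.
rewrite mulr_suml mulr_sumr; apply: eq_bigr => y _.
rewrite mulr_suml mulr_sumr; apply: eq_bigr => z _.
rewrite mulr_sumr mulr_sumr; apply: eq_bigr => x' _.
rewrite mulr_sumr mulr_sumr; apply: eq_bigr => y' _.
by rewrite mulr_sumr mulr_sumr.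
Qed.

Definition half_term (A : 'M[F]_(16, 7)) (x y z : {ffun 'I_4 -> 'I_7}) (i j : nat) : F :=
  theta A x * (theta A y * (theta A z *
    (signs F x y z (slot 0) (slot 2) i * signs F x y z (slot 1) (slot 3) j))).

Definition half_sum (A : 'M[F]_(16, 7)) (i j : nat) : F :=
  \sum_x \sum_y \sum_z half_term A x y z i j.

Lemma signs_tuples (x : {ffun 'I_7 -> {ffun 'I_4 -> 'I_7}}) :
  zval (vdm (iota 0 7)) ^+ 4 * \prod_j \det (mxsub (tuples x j) id 1%:M)
    = signs F (x (entry 0)) (x (entry 1)) (x (entry 2)) (slot 0) (slot 2) (x (entry 6) (slot 0)) *
      signs F (x (entry 0)) (x (entry 1)) (x (entry 2)) (slot 1) (slot 3) (x (entry 6) (slot 1)) *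
      (signs F (x (entry 3)) (x (entry 4)) (x (entry 5)) (slot 0) (slot 2) (x (entry 6) (slot 2)) *
       signs F (x (entry 3)) (x (entry 4)) (x (entry 5)) (slot 1) (slot 3) (x (entry 6) (slot 3))).
Proof.
transitivity (\prod_(j < 4) zval (vdm [seq val (tuples x j a) | a <- enum 'I_7])).
  under [RHS]eq_bigr => j _ do rewrite vdm_det.
  by rewrite big_split prodr_const card_ord.
rewrite 4!big_ord_recl big_ord0 mulr1 !mulrA /signs !map_enum7.
congr (_ * _ * _ * _); congr (zval (vdm _)); do ![congr (_ :: _)];
  by congr val; apply: tuplesE; rewrite /= inordK.
Qed.

(** Once the quadruple 6 is fixed, the quadruples 0, 1, 2 meet only the first two tuples and 3, 4, 5
    only the last two, so the remaining sum is a product of two half sums. *)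
Lemma invariant_half_sums X :
  zval (vdm (iota 0 7)) ^+ 4 * invariant (plucker X)
    = \sum_(g : {ffun 'I_4 -> 'I_7}) theta (cols_mx X) g *
        (half_sum (cols_mx X) (g (slot 0)) (g (slot 1)) *
         half_sum (cols_mx X) (g (slot 2)) (g (slot 3))).
Proof.
rewrite invariant_plucker /contraction mulr_sumr.
rewrite (reindex (@tuples 'I_7)) /=; last first.
  by apply: onW_bij; exists (@quads _); [exact: tuplesK | exact: quadsK].
set A := cols_mx _.
transitivity (\sum_(x : {ffun 'I_7 -> {ffun 'I_4 -> 'I_7}}) theta A (x (entry 6)) *
  (half_term A (x (entry 0)) (x (entry 1)) (x (entry 2)) (x (entry 6) (slot 0)) (x (entry 6) (slot 1)) *
   half_term A (x (entry 3)) (x (entry 4)) (x (entry 5)) (x (entry 6) (slot 2)) (x (entry 6) (slot 3)))).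
  apply: eq_bigr => x _; rewrite mulrCA.
  have -> : theta_prod A (tuples x) = \prod_r theta A (x r) by rewrite /theta_prod tuplesK.
  rewrite [X in _ * X]signs_tuples prod_ord7 /half_term; ring.
rewrite (sum_ffun7 (fun a b c d e f (g : {ffun 'I_4 -> 'I_7}) => theta A g *
   (half_term A a b c (g (slot 0)) (g (slot 1)) * half_term A d e f (g (slot 2)) (g (slot 3))))).
by apply: eq_bigr => g _; rewrite -mul_sum3.
Qed.

Lemma half_sumE vs (i j : nat) : size vs = 7%N ->
  let p := zalt (ztheta (zgrams [seq mkseq (zcoord v) 16 | v <- vs])) in
  zeval (zcofactor (zwedge (zwedge p p) p) i j) = half_sum (cols_mx (tuple_of t d vs)) i j.
Proof. by move=> vs7 p; rewrite (cofactor_sum t d vs7). Qed.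

Lemma zinvariantE vs : size vs = 7%N ->
  zeval (zinvariant vs) = zval (vdm (iota 0 7)) ^+ 4 * invariant (plucker (tuple_of t d vs)).
Proof.
move=> vs7; rewrite invariant_half_sums.
rewrite (sum_theta_nat t d vs7 (fun i j k l => half_sum _ i j * half_sum _ k l)) /zinvariant.
have memoE p (i j : 'I_7) :
    zentry (mkseq (fun i => mkseq (zcofactor p i) 7) 7) i j = zcofactor p i j.
  by rewrite /zentry !nth_mkseq.
rewrite zeval_sum -[iota 0 7]/(index_iota 0 7) big_mkord; apply: eq_bigr => i _.
rewrite zeval_sum big_mkord; apply: eq_bigr => j _.
rewrite zeval_sum big_mkord; apply: eq_bigr => k _.
rewrite zeval_sum big_mkord; apply: eq_bigr => l _.
rewrite zeval_mul [zeval (zmul (zentry _ _ _) _)]zeval_mul.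
by congr (_ * (_ * _)); rewrite memoE; apply: half_sumE.
Qed.

End Evaluation.

(** * The three kinds of points *)

Definition zint (n : int) : zpoly := zconst (Z_of_int n).

Definition cusp_vectors : seq zvector :=
  [:: [:: ([:: 1; 5], zint (-3)); ([:: 2; 3], zint 5)];
      [:: ([:: 2; 5], zint 1); ([:: 3; 4], zint 5)];
      [:: ([:: 3; 5], zint 3); ([:: 4; 5], zint 4)];
      [:: ([::], zint 30); ([:: 1; 2; 3; 4], zint 1)];
      [:: ([:: 1; 2; 3; 5], zint 8); ([:: 1; 2; 4; 5], zint 9)];
      [:: ([:: 1; 2], zint (-2)); ([:: 1; 3; 4; 5], zint 1)];
      [:: ([:: 1; 4], zint (-15)); ([:: 2; 3; 4; 5], zint 2)]]%N.

Definition rib_vectors : seq zvector :=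
  [:: [:: ([:: 1; 4], zint 1); ([:: 2; 3], zint 1)];
      [:: ([:: 1; 5], zint 1); ([:: 2; 4], zint 2)];
      [:: ([:: 2; 5], zint 2); ([:: 3; 4], zint 1)];
      [:: ([:: 3; 5], zint 1)];
      [:: ([:: 1; 2; 4; 5], zint 1)];
      [:: ([:: 1; 2], zint 1); ([:: 1; 3; 4; 5], zint 1)];
      [:: ([:: 1; 3], zint 1); ([:: 2; 3; 4; 5], zint 1)]]%N.

(* The two variables stand for t1 and t0 - t1. *)
Definition nod_vectors : seq zvector :=
  let t1 : zpoly := [:: [:: Z0; Z.one]] in
  let d : zpoly := [:: [::]; [:: Z.one]] in
  [:: [:: ([:: 1; 2], zint 1); ([:: 1; 3], zint 1)];
      [:: ([:: 2; 4], zint 1)];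
      [:: ([:: 3; 4], zint 1)];
      [:: ([::], zmul t1 d); ([:: 1; 5], d); ([:: 2; 3], t1); ([:: 2; 5], t1);
          ([:: 3; 5], zadd t1 d)];
      [:: ([:: 2; 3], zint 1); ([:: 2; 5], zint 1); ([:: 4; 5], zint 1)];
      [:: ([:: 1; 2; 3; 5], zint 1)];
      [:: ([:: 1; 3; 4; 5], zint 1)]]%N.

Section Points.
Variable F : numFieldType.

Lemma zeval_int (t d : F) n : zeval t d (zint n) = n%:~R.
Proof. by rewrite zeval_const /zval Z_of_intK. Qed.

(** The scalars c allow generators to be replaced by multiples whose coefficients are integer
    polynomials. *)
Lemma semistable_span (t d : F) (gs : seq 'cV[F]_16) (vs : seq zvector) :
  size gs = 7%N -> size vs = 7%N ->
  (forall i, (i < 7)%N -> exists c, vector_of t d (nth [::] vs i) = c *: gs`_i) ->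
  zeval t d (zinvariant vs) != 0 -> Spin_semistable <<gs>>%VS.
Proof.
move=> gs7 vs7 vsP; rewrite zinvariantE // mulf_eq0 negb_or => /andP[_ nz].
apply: semistable_of_tuple nz => [i|]; last by rewrite (leq_trans (dim_span gs)) ?gs7.
rewrite tnth_mktuple; have [c ->] := vsP _ (ltn_ord i).
by rewrite memvZ // memv_span // mem_nth // gs7.
Qed.

Lemma zval_neq0 z : z <> Z0 -> zval F z != 0.
Proof.
move=> nz; rewrite /zval intr_eq0; apply/eqP => z0; apply: nz.
by rewrite -[z]int_of_ZK z0.
Qed.

Lemma zinvariant_cusp : exists2 z, z <> Z0 & zinvariant cusp_vectors = [:: [:: z]].
Proof. by eexists; last (vm_compute; reflexivity). Qed.

Lemma zinvariant_rib : exists2 z, z <> Z0 & zinvariant rib_vectors = [:: [:: z]].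
Proof. by eexists; last (vm_compute; reflexivity). Qed.

(** Outer position 3 and inner position 2 give the monomial t1^2 (t0 - t1)^3. The last list consists
    of cancelled coefficients, since the arithmetic does not trim zeros. *)
Lemma zinvariant_nod : exists2 z, z <> Z0 &
  zinvariant nod_vectors = [:: [::]; [::]; [::]; [:: Z0; Z0; z]; [:: Z0; Z0]].
Proof. by eexists; last (vm_compute; reflexivity). Qed.

Lemma P_cusp_semistable : Spin_semistable (P_cusp F).
Proof.
apply: (semistable_span (t := 0) (d := 0) (vs := cusp_vectors)) => //.
  move=> i i7.
  (* These scalars clear the denominators of the seven generators. *)
  exists (nth 0 [:: 5; 5; 4; 1; 9; 1; 2] i).
  move: i i7 => [|[|[|[|[|[|[|i]]]]]]] // _;
    rewrite /vector_of [nth _ _ _]/= [in RHS]/= !big_cons big_nil addr0 !zeval_int /=;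
    by rewrite [in RHS]scalerDr [in RHS]scalerA; congr (_ *: _ + _ *: _); field.
have [z nz ->] := zinvariant_cusp.
by rewrite zeval_const zval_neq0.
Qed.

Lemma P_rib_semistable : Spin_semistable (P_rib F).
Proof.
apply: (semistable_span (t := 0) (d := 0) (vs := rib_vectors)) => //.
  move=> i i7.
  exists (nth 0 [:: 1; 2; 1; 1; 1; 1; 1] i).
  move: i i7 => [|[|[|[|[|[|[|i]]]]]]] // _;
    rewrite /vector_of [nth _ _ _]/= [in RHS]/= !big_cons big_nil !addr0 !zeval_int /=
      ?scale1r //.
  have e2 : 2 * (1 / 2) = 1 :> F by field.
  by rewrite scalerDr scalerA e2 scale1r.
have [z nz ->] := zinvariant_rib.
by rewrite zeval_const zval_neq0.
Qed.

Lemma P_nod_semistable (t0 t1 : F) : t0 != t1 -> t1 != 0 -> Spin_semistable (P_nod t0 t1).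
Proof.
move=> t01 t1nz.
apply: (semistable_span (t := t1) (d := t0 - t1) (vs := nod_vectors)) => //.
  move=> i i7; exists 1; rewrite scale1r.
  move: i i7 => [|[|[|[|[|[|[|i]]]]]]] // _;
    rewrite /vector_of [nth _ _ _]/= [in RHS]/= !big_cons big_nil addr0 ?zeval_int /=
      ?scale1r ?addrA //.
  have [z0 z1 z1'] : [/\ zval F Z0 = 0, zval F Z.one = 1 & zval F (Zpos xH) = 1] by [].

  by rewrite -!addrA; congr (_ *: _ + (_ *: _ + (_ *: _ + (_ *: _ + _ *: _))));
    rewrite ?z0 ?z1 ?z1'; ring.
have [z nz ->] := zinvariant_nod.
have -> : zeval t1 (t0 - t1) [:: [::]; [::]; [::]; [:: Z0; Z0; z]; [:: Z0; Z0]]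
    = t1 ^+ 2 * (t0 - t1) ^+ 3 * zval F z.
  by rewrite /zeval /= (_ : zval F Z0 = 0) //; ring.
by rewrite !mulf_neq0 ?expf_neq0 ?subr_eq0 ?zval_neq0.
Qed.

End Points.

Local Open Scope complex_scope.

Theorem theorem6p6 (R : realType) :
  [/\ Spin_semistable (P_cusp R[i]),
      Spin_semistable (P_rib R[i])
    & forall t0 t1 : R[i], t0 <> t1 -> t1 <> 0 ->
        Spin_semistable (P_nod t0 t1)].
Proof.
split; [exact: P_cusp_semistable | exact: P_rib_semistable |].
by move=> t0 t1 /eqP t01 /eqP t1nz; apply: P_nod_semistable.
Qed.
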